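(* Let $X$ be a complex manifold and $X_t$ a small deformation of $X$ whose complex structure is represented by a Beltrami differential $\phi(t)\in A^{0,1}(X,T_X^{1,0})$. Let $E$ be a holomorphic tensor bundle on $X$ and $E_t$ the corresponding holomorphic tensor bundle on $X_t$. Then the complexes $(A^{0,\bullet}(X,E),\bar\partial_{\phi(t)})$ and $(A^{0,\bullet}(X_t,E_t),\bar\partial_t)$ are isomorphic. In particular, $$H^{0,q}_{\bar\partial_{\phi(t)}}(X,E)\cong H^{0,q}_{\bar\partial_t}(X_t,E_t),\qquad\forall q\ge0.$$
   Context: A holomorphic tensor bundle is a holomorphic vector bundle formed by tensor products or exterior products from $T_X^{1,0}$ and its dual $\Omega_X$. $A^{0,q}(X,E)$ is the space of smooth $E$-valued $(0,q)$-forms, and $\bar\partial,\bar\partial_t$ are the Dolbeault operators on $X,X_t$. **Beltrami differential.** $X_t$ is identified with $X$ as a smooth manifold by a fixed smooth trivialization of the family, with $t$ sufficiently small. With $z,w$ local holomorphic coordinates on $X,X_t$, $\phi(t)=\big((\partial w/\partial z)^{-1}\big)_{\alpha i}\frac{\partial w^i}{\partial\bar z^\beta}\,d\bar z^\beta\otimes\frac{\partial}{\partial z^\alpha}$; it satisfies $\bar\partial\phi(t)=\frac12[\phi(t),\phi(t)]$. **Deformed Dolbeault complex.** For $\varphi=\xi\otimes v$ with $\xi$ a $(0,k)$-form and $v$ a $(1,0)$-vector field, $i_\varphi\beta=\xi\wedge(v\lrcorner\beta)$ (extended linearly), and $\mathcal L^{1,0}_\varphi=i_\varphi\partial-(-1)^{k-1}\partial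 i_\varphi$ on forms. $[\cdot,\cdot]$ is the Frölicher–Nijenhuis bracket: for $\varphi=\varphi^\alpha\otimes\partial_\alpha$ of degree $k$ and $\psi=\psi^\beta\otimes\partial_\beta$ of degree $l$, $[\varphi,\psi]=\big(\varphi^\alpha\wedge\partial_\alpha\psi^\beta-(-1)^{kl}\psi^\alpha\wedge\partial_\alpha\varphi^\beta\big)\otimes\partial_\beta$, where $\partial_\alpha=\partial/\partial z^\alpha$. The operator $\langle\varphi|:A^{0,\bullet}(X,E)\to A^{0,\bullet+k}(X,E)$ equals $[\varphi,\cdot]$ on $A^{0,\bullet}(X,T_X^{1,0})$, equals $\mathcal L_\varphi^{1,0}$ on $A^{0,\bullet}(X)$ and on $A^{0,\bullet}(X,\Omega_X)$ (identify $\beta\otimes s$ with $\beta\wedge s$), and is extended by Leibniz's rule: $\langle\varphi|(\beta\otimes e_1\otimes\cdots\otimes e_m)=\mathcal L^{1,0}_\varphi\beta\otimes e_1\otimes\cdots\otimes e_m+(-1)^{kq}\sum_i\beta\wedge(e_1\otimes\cdots\otimes\langle\varphi|e_i\otimes\cdots\otimes e_m)$ for a $(0,q)$-form $\beta$ (form parts moved to the front), similarly for exterior products. Put $\bar\partial_{\phi(t)}:=\bar\partial-\langle\phi(t)|$ on $A^{0,\bullet}(X,E)$ (it squares to zero), and let $H^{0,q}_{\bar\partial_{\phi(t)}}(X,E)$ be the degree $q$ cohomology of $(A^{0,\bullet}(X,E),\bar\partial_{\phi(t)})$. *)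

(* Defs.v *)
From HB Require Import structures.
From mathcomp Require Import all_boot all_order all_algebra perm.
From mathcomp Require Import all_classical all_reals all_analysis.
From mathcomp Require Import complex.

Set Implicit Arguments.
Unset Strict Implicit.
Unset Printing Implicit Defensive.

Import Order.TTheory GRing.Theory Num.Theory numFieldNormedType.Exports.

Local Open Scope classical_set_scope.
Local Open Scope ring_scope.

Definition Cplx (R : rcfType) : numClosedFieldType := R[i].

(* C^n with its underlying real normed space: row 0 holds the real parts and
   row 1 the imaginary parts of the n complex coordinates; C^n x C^m is
   identified with C^(n+m) by [row_mx]. *)
Definition Cn (R : realType) (n : nat) : normedModType R := 'M[R]_(2, n).

Definition coord (R : realType) n (k : 'I_n) (z : Cn R n) : Cplx R :=
  Complex (z ord0 k) (z ord_max k).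

(* Meant for open [U]. *)
Fixpoint Ck (R : realType) (V W : normedModType R) (k : nat)
    (U : set V) (f : V -> W) : Prop :=
  if k is k'.+1 then
    (forall x, U x -> differentiable f x) /\
    (forall v, Ck k' U (fun x => 'D_v f x))
  else forall x, U x -> {for x, continuous f}.

Definition smooth_on (R : realType) (V W : normedModType R)
    (U : set V) (f : V -> W) : Prop := forall k, Ck k U f.

Section Wirtinger.
Variables (R : realType) (n : nat).
Implicit Types (f : Cn R n -> Cplx R) (v z : Cn R n) (a : 'I_n).

Definition smoothC_on (U : set (Cn R n)) f : Prop :=
  smooth_on U (fun z => complex.Re (f z) : R^o) /\
  smooth_on U (fun z => complex.Im (f z) : R^o).

Definition dirC f v z : Cplx R :=
  Complex ('D_v (fun y => complex.Re (f y) : R^o) z)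
          ('D_v (fun y => complex.Im (f y) : R^o) z).

Definition dx a : Cn R n := delta_mx ord0 a.
Definition dy a : Cn R n := delta_mx ord_max a.

Definition dz a f z : Cplx R :=
  2^-1 * (dirC f (dx a) z - 'i * dirC f (dy a) z).

Definition dzbar a f z : Cplx R :=
  2^-1 * (dirC f (dx a) z + 'i * dirC f (dy a) z).

End Wirtinger.

Definition holomorphic_on (R : realType) n m (U : set (Cn R n))
    (f : Cn R n -> Cn R m) : Prop :=
  smooth_on U f /\
  forall z, U z -> forall (a : 'I_n) (k : 'I_m), dzbar a (coord k \o f) z = 0.

(* Raw charts; [inv i] is only meaningful on [chart i @` dom i]. *)
Record atlas (R : realType) (X : Type) (n : nat) := Atlas {
  idx : Type;
  dom : idx -> set X;
  chart : idx -> X -> Cn R n;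
  inv : idx -> Cn R n -> X }.

Section Atlas.
Variables (R : realType) (n : nat).

Definition cod (X : Type) (A : atlas R X n) (i : idx A) : set (Cn R n) :=
  chart i @` dom i.

Definition overlap (X : Type) (A A' : atlas R X n) (i : idx A) (j : idx A') :
    set (Cn R n) :=
  chart i @` (dom i `&` dom j).

Definition trans (X : Type) (A A' : atlas R X n) (i : idx A) (j : idx A') :
    Cn R n -> Cn R n :=
  chart j \o inv i.

(* The identity map between the two charted spaces is a diffeomorphism. *)
Definition smooth_compatible (X : Type) (A A' : atlas R X n) : Prop :=
  forall (i : idx A) (j : idx A'),
    smooth_on (overlap i j) (trans i j) /\ smooth_on (overlap j i) (trans j i).

(* The identity map between the two charted spaces is biholomorphic. *)
Definition holo_compatible (X : Type) (A A' : atlas R X n) : Prop :=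
  forall (i : idx A) (j : idx A'),
    holomorphic_on (overlap i j) (trans i j) /\
    holomorphic_on (overlap j i) (trans j i).

(* [A] is a holomorphic atlas of dimension n on the open subset [S] of [X]. *)
Record complex_atlas (X : topologicalType) (S : set X) (A : atlas R X n) :
    Prop := ComplexAtlas {
  atlas_dom_open : forall i : idx A, open (dom i);
  atlas_cover : \bigcup_(i : idx A) dom i = S;
  atlas_cod_open : forall i : idx A, open (cod i);
  atlas_invK : forall (i : idx A) x, dom i x -> inv i (chart i x) = x;
  atlas_chart_cont :
    forall (i : idx A) x, dom i x -> {for x, continuous (chart i)};
  atlas_inv_cont :
    forall (i : idx A) z, cod i z -> {for z, continuous (inv i)};
  atlas_holo : holo_compatible A A }.

Record complex_manifold (X : topologicalType) (A : atlas R X n) : Prop :=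
  ComplexManifold {
  manifold_hausdorff : hausdorff_space X;
  manifold_second_countable : @second_countable X;
  manifold_atlas : complex_atlas [set: X] A }.

End Atlas.

Section Deformation.
Variables (R : realType) (X : topologicalType) (n m : nat).

(* The product of [A] with the open subset [B] of C^m. *)
Definition prod_atlas (A : atlas R X n) (B : set (Cn R m)) :
    atlas R (X * Cn R m)%type (n + m) :=
  {| idx := idx A;
     dom := fun i => dom i `*` B;
     chart := fun i p => row_mx (chart i p.1) p.2;
     inv := fun i u => (inv i (lsubmx u), rsubmx u) |}.

(* The complex structure X_t induced on X = X x {t} by charts of X x B of the
   form (x, t) |-> (w (x, t), t). *)
Definition fiber (F : atlas R (X * Cn R m)%type (n + m)) (t : Cn R m) :
    atlas R X n :=
  {| idx := idx F;
     dom := fun j => [set x | dom j (x, t)];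
     chart := fun j x => lsubmx (chart j (x, t));
     inv := fun j w => (inv j (row_mx w t)).1 |}.

(* A complex analytic family over the open neighbourhood [B] of 0 in C^m whose
   central fibre is [X], together with a smooth trivialization: the latter is
   used to take X x B for the underlying smooth manifold of the total space.
   The charts of [F] are adapted to the projection to [B]; these form an atlas
   because the projection is a holomorphic submersion. *)
Record deformation (A : atlas R X n) (B : set (Cn R m))
    (F : atlas R (X * Cn R m)%type (n + m)) : Prop := Deformation {
  deform_base_open : open B;
  deform_base_0 : B 0;
  deform_atlas : complex_atlas ([set: X] `*` B) F;
  deform_proj : forall (j : idx F) p, dom j p -> rsubmx (chart j p) = p.2;
  deform_smooth_triv : smooth_compatible (prod_atlas A B) F;
  deform_central : holo_compatible A (fiber F 0) }.

End Deformation.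

Inductive tensor_bundle : Type :=
| Tangent
| Cotangent
| Tensor of tensor_bundle & tensor_bundle
| Exterior of nat & tensor_bundle.

Section TensorBundle.
Variables (R : realType) (n : nat).

(* Indices of the components in the frame induced by the coordinates. The p-th
   exterior power is the space of alternating elements of the p-th tensor
   power, see [in_fiber]. *)
Fixpoint tidx (E : tensor_bundle) : finType :=
  match E with
  | Tangent | Cotangent => 'I_n
  | Tensor E1 E2 => (tidx E1 * tidx E2)%type
  | Exterior p E1 => {ffun 'I_p -> tidx E1}
  end.

Definition alternating (p : nat) (T : Type) (V : zmodType)
    (c : {ffun 'I_p -> T} -> V) : Prop :=
  forall (s : 'S_p) (I : {ffun 'I_p -> T}),
    c [ffun k => I (s k)] = if odd_perm s then - c I else c I.

Fixpoint in_fiber (E : tensor_bundle) : (tidx E -> Cplx R) -> Prop :=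
  match E with
  | Tangent | Cotangent => fun _ => True
  | Tensor E1 E2 => fun c =>
      (forall e2, in_fiber (fun e1 => c (e1, e2))) /\
      (forall e1, in_fiber (fun e2 => c (e1, e2)))
  | Exterior p E1 => fun c =>
      alternating c /\
      forall (I : {ffun 'I_p -> tidx E1}) (k : 'I_p),
        in_fiber (fun e => c [ffun l => if l == k then e else I l])
  end.

(* The matrix by which components in the coordinates z change to components
   in the coordinates z', where g is the Jacobian matrix of z' in z. *)
Fixpoint tensor_mx (E : tensor_bundle) (g : 'M[Cplx R]_n) :
    tidx E -> tidx E -> Cplx R :=
  match E with
  | Tangent => fun a b => g a b
  | Cotangent => fun a b => invmx g b a
  | Tensor E1 E2 => fun a b => tensor_mx g a.1 b.1 * tensor_mx g a.2 b.2
  | Exterior p E1 => fun a b => \prod_(k < p) tensor_mx g (a k) (b k)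
  end.

End TensorBundle.

Section LocalOperators.
Variables (R : realType) (n : nat).
Local Notation mi q := {ffun 'I_q -> 'I_n}.

(* A (0,q)-form is given by its values on (d/dzbar^{B_1},..,d/dzbar^{B_q}):
   b = 1/q! \sum_B b_B dzbar^B. A (p,q)-form is
   a = 1/(p! q!) \sum_(A, B) a_(A, B) dz^A /\ dzbar^B. *)
Definition form0 (q : nat) := mi q -> Cn R n -> Cplx R.
Definition form (p q : nat) := mi p -> form0 q.
(* E-valued (0,q)-forms, in the frame induced by the coordinates. *)
Definition tform (E : tensor_bundle) (q : nat) :=
  mi q -> tidx n E -> Cn R n -> Cplx R.

Definition component (E : tensor_bundle) q (s : tform E q) (e : tidx n E) :
    form0 q :=
  fun B => s B e.

Definition omit q (k : 'I_q.+1) (B : mi q.+1) : mi q :=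
  [ffun j => B (lift k j)].
Definition cons_idx q (a : 'I_n) (B : mi q) : mi q.+1 :=
  [ffun k => if unlift ord0 k is Some j then B j else a].

(* eta /\ b for a (0,1)-form eta. *)
Definition wedgel q (eta : form0 1) (b : form0 q) : form0 q.+1 := fun B z =>
  \sum_(k < q.+1) (-1) ^+ k * (eta [ffun=> B k] z * b (omit k B) z).

(* b /\ eta for a (0,1)-form eta. *)
Definition wedger q (b : form0 q) (eta : form0 1) : form0 q.+1 := fun B z =>
  \sum_(k < q.+1) (-1) ^+ (q - k) * (b (omit k B) z * eta [ffun=> B k] z).

Definition dform0 (a : 'I_n) q (b : form0 q) : form0 q := fun B => dz a (b B).

Definition del p q (a : form p q) : form p.+1 q := fun A B z =>
  \sum_(k < p.+1) (-1) ^+ k * dz (A k) (a (omit k A) B) z.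

Variable phi : tform Tangent 1.

(* The (0,1)-form phi^a in phi = phi^a (x) d/dz^a. *)
Definition phi_comp (a : 'I_n) : form0 1 := @component Tangent 1 phi a.

(* i_phi a = \sum_c phi^c /\ (d/dz^c _| a); the sign comes from moving dzbar
   past dz^A. On (0,q)-forms i_phi vanishes. *)
Definition contr p q (a : form p.+1 q) : form p q.+1 := fun A B z =>
  (-1) ^+ p * \sum_c wedgel (phi_comp c) (a (cons_idx c A)) B z.

(* L^{1,0}_phi = i_phi del - del i_phi, as phi has degree 1. *)
Definition lie p q : form p q -> form p q.+1 :=
  match p with
  | 0 => fun a => contr (del a)
  | p'.+1 => fun a A B z => contr (del a) A B z - del (contr a) A B z
  end.

Definition lie0 q (b : form0 q) : form0 q.+1 :=
  @lie 0 q (fun=> b) (ffun0 (card_ord 0)).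

(* [phi, psi] for phi of degree 1 and psi of degree l. *)
Definition bracket l (psi : tform Tangent l) : tform Tangent l.+1 :=
  fun B (b : 'I_n) z =>
  \sum_a (wedgel (phi_comp a) (dform0 a (@component Tangent l psi b)) B z
          - (-1) ^+ l *
            wedger (@component Tangent l psi a) (dform0 a (phi_comp b)) B z).

(* beta (x) s <-> beta /\ s: dzbar^B (x) dz^c <-> (-1)^q dz^c /\ dzbar^B. *)
Definition form_of_cotangent q (s : tform Cotangent q) : form 1 q :=
  fun A B z => (-1) ^+ q * s B (A ord0) z.
Definition cotangent_of_form q (a : form 1 q) : tform Cotangent q :=
  fun B (c : 'I_n) z => (-1) ^+ q * a [ffun=> c] B z.

Definition frame (E : tensor_bundle) (e : tidx n E) : tform E 0 :=
  fun _ e' _ => (e' == e)%:R.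

(* The E-valued (0,1)-form <phi| e, for e in the frame of E. *)
Fixpoint ang_frame (E : tensor_bundle) : tidx n E -> tform E 1 :=
  match E with
  | Tangent => fun a => bracket (@frame Tangent a)
  | Cotangent => fun a =>
      cotangent_of_form (lie (form_of_cotangent (@frame Cotangent a)))
  | Tensor E1 E2 => fun e B e' z =>
      ang_frame e.1 B e'.1 z * (e'.2 == e.2)%:R +
      (e'.1 == e.1)%:R * ang_frame e.2 B e'.2 z
  | Exterior p E1 => fun e B e' z =>
      \sum_(k < p) ang_frame (e k) B (e' k) z *
                   \prod_(l < p | l != k) (e' l == e l)%:R
  end.

(* <phi| (\sum_e s_e (x) e) by Leibniz's rule. *)
Definition ang (E : tensor_bundle) q (s : tform E q) : tform E q.+1 :=
  fun B e' z =>
  lie0 (component s e') B z +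
  (-1) ^+ q * \sum_(e : tidx n E)
    wedger (component s e) (component (ang_frame e) e') B z.

Definition delbar (E : tensor_bundle) q (s : tform E q) : tform E q.+1 :=
  fun B e z => \sum_(k < q.+1) (-1) ^+ k * dzbar (B k) (s (omit k B) e) z.

End LocalOperators.

(* Subspaces [obj q] of ambient vector spaces [amb q], with maps [diff q] whose
   values matter on [obj q] only. *)
Record cochain_data (K : fieldType) := CochainData {
  amb : nat -> lmodType K;
  obj : forall q, set (amb q);
  diff : forall q, amb q -> amb q.+1 }.

Arguments obj {K} C q _ : rename.
Arguments diff {K} C q _ : rename.

Record is_complex (K : fieldType) (C : cochain_data K) : Prop := IsComplex {
  complex_0 : forall q, obj C q 0;
  complex_lin : forall q (a : K) s s',
    obj C q s -> obj C q s' -> obj C q (a *: s + s');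
  complex_diff : forall q s, obj C q s -> obj C q.+1 (diff C q s);
  complex_diff_lin : forall q (a : K) s s', obj C q s -> obj C q s' ->
    diff C q (a *: s + s') = a *: diff C q s + diff C q s';
  complex_diffK : forall q s, obj C q s -> diff C q.+1 (diff C q s) = 0 }.

Definition complex_iso (K : fieldType) (C C' : cochain_data K) : Prop :=
  exists f : forall q, amb C q -> amb C' q,
    [/\ forall q, set_bij (obj C q) (obj C' q) (f q),
        forall q (a : K) s s', obj C q s -> obj C q s' ->
          f q (a *: s + s') = a *: f q s + f q s'
      & forall q s, obj C q s -> f q.+1 (diff C q s) = diff C' q (f q s)].

Definition cocycles (K : fieldType) (C : cochain_data K) (q : nat) :
    set (amb C q) :=
  [set s | obj C q s /\ diff C q s = 0].

Arguments cocycles {K} C q _.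

Definition coboundaries (K : fieldType) (C : cochain_data K) (q : nat) :
    set (amb C q) :=
  match q with
  | 0 => [set 0]
  | q'.+1 => diff C q' @` obj C q'
  end.

Arguments coboundaries {K} C q _.

(* The set of cosets s + coboundaries, for s a cocycle. *)
Definition cohomology (K : fieldType) (C : cochain_data K) (q : nat) :
    set (set (amb C q)) :=
  [set [set s + b | b in coboundaries C q] | s in cocycles C q].

Arguments cohomology {K} C q _.

(* The operation (u, v) |-> a u + v on cosets. *)
Definition coset_lin (K : fieldType) (V : lmodType K) (a : K) (u v : set V) :
    set V :=
  [set a *: x + y | x in u & y in v].

Definition cohomology_iso (K : fieldType) (C C' : cochain_data K) (q : nat) :
    Prop :=
  exists f : set (amb C q) -> set (amb C' q),
    set_bij (cohomology C q) (cohomology C' q) f /\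
    forall (a : K) u v, cohomology C q u -> cohomology C q v ->
      f (coset_lin a u v) = coset_lin a (f u) (f v).

Section GlobalForms.
Variables (R : realType) (n : nat) (X : Type).
Variables (A : atlas R X n) (E : tensor_bundle).

(* Families of local components; they are required to vanish outside the
   chart images, so that equal forms have equal families. *)
Definition cochain (q : nat) : lmodType (Cplx R) :=
  idx A -> {ffun 'I_q -> 'I_n} -> tidx n E -> Cn R n -> (Cplx R)^o.

Definition jac (A' : atlas R X n) (i : idx A) (j : idx A') (z : Cn R n) :
    'M[Cplx R]_n :=
  \matrix_(k, a) dz a (coord k \o trans i j) z.

Definition jacbar (A' : atlas R X n) (i : idx A) (j : idx A') (z : Cn R n) :
    'M[Cplx R]_n :=
  \matrix_(k, a) dzbar a (coord k \o trans i j) z.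

(* The elements of A^{0,q}(X, E). *)
Record is_form (q : nat) (s : cochain q) : Prop := IsForm {
  form_smooth : forall i B e, smoothC_on (cod i) (s i B e);
  form_alt : forall i e z, alternating (fun B => s i B e z);
  form_fiber : forall i B z, in_fiber (fun e => s i B e z);
  form_off : forall i B e z, ~ cod i z -> s i B e z = 0;
  form_trans : forall (i j : idx A) x, dom i x -> dom j x -> forall B e,
    s j B e (chart j x) =
      \sum_(B' : {ffun 'I_q -> 'I_n}) \sum_(e' : tidx n E)
        (\prod_(k < q) (invmx (jac i j (chart i x)) (B' k) (B k))^*) *
        tensor_mx (jac i j (chart i x)) e e' * s i B' e' (chart i x) }.

Definition forms (q : nat) : set (cochain q) := [set s | is_form s].

Definition globalize q
    (D : forall i : idx A, tform R n E q -> tform R n E q.+1) (s : cochain q) :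
    cochain q.+1 :=
  fun i B e z => if `[< cod i z >] then D i (s i) B e z else 0.

(* (A^{0,.}(X, E), delbar) *)
Definition dolbeault_complex : cochain_data (Cplx R) := {|
  amb := cochain;
  obj := forms;
  diff := fun q => globalize (fun=> @delbar R n E q) |}.

(* (A^{0,.}(X, E), delbar - <phi|) *)
Definition deformed_dolbeault_complex
    (phi : idx A -> tform R n Tangent 1) : cochain_data (Cplx R) := {|
  amb := cochain;
  obj := forms;
  diff := fun q =>
    globalize (fun i s B e z => delbar s B e z - ang (phi i) s B e z) |}.

End GlobalForms.

(* [phi] is the Beltrami differential of the complex structure [A'] with respect
   to [A]: with z in [A] and w in [A'], the matrix dw/dz is invertible and
   phi = (dw/dz)^-1 dw/dzbar. For a deformation, invertibility is what the
   smallness of the parameter provides. *)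
Record beltrami (R : realType) n (X : Type) (A A' : atlas R X n)
    (phi : cochain A Tangent 1) : Prop := Beltrami {
  beltrami_form : forms phi;
  beltrami_unit : forall (i : idx A) (j : idx A') x, dom i x -> dom j x ->
    jac i j (chart i x) \in unitmx;
  beltrami_eq : forall (i : idx A) (j : idx A') x, dom i x -> dom j x ->
    forall a b : 'I_n,
    phi i [ffun=> b] a (chart i x) =
      (invmx (jac i j (chart i x)) *m jacbar i j (chart i x)) a b }.

(* Main.v *)
From HB Require Import structures.
From mathcomp Require Import all_boot all_order all_algebra perm.
From mathcomp Require Import all_classical all_reals all_analysis.
From mathcomp Require Import complex ring zify.
Require Import Defs.

(** Idea. Let z, w be local holomorphic coordinates on X and X_t, J = dw/dz, and
    D_b = d/dzbar^b - phi^a_b d/dz^a. Since J phi = dw/dzbar, the fields D_b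
    annihilate the functions w^i, so they span T^{0,1} X_t, and d/dwbar^c is
    N^b_c D_b with N the conjugate of dz/dw. Restricting dzbar^b to T^{0,1} X_t
    and projecting T^{1,0} X onto T^{1,0} X_t therefore gives an isomorphism of
    E-valued (0,q)-forms, with matrix N on the form indices and the tensor
    representation of J on the indices of E. It intertwines the two operators:
    the derivatives of N cancel after antisymmetrization because N is a conjugate
    Jacobian, and D_b J = J (d_a phi^c_b), which is the connection form of <phi|,
    because D_b commutes with d/dz^a up to that matrix and kills w. Everything else
    about the deformed operator is transported from X_t; in particular it preserves
    forms and squares to zero without using the Maurer-Cartan equation. The case
    phi = 0 is the invariance of the Dolbeault operator under holomorphic changes
    of coordinates. *)

Set Implicit Arguments.
Unset Strict Implicit.
Unset Printing Implicit Defensive.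

Import Order.TTheory GRing.Theory Num.Theory numFieldNormedType.Exports.

Local Open Scope classical_set_scope.
Local Open Scope ring_scope.

(** * C^k functions *)

(** The analytic input is the Wirtinger chain rule and the symmetry of second derivatives. Symmetry
    serves three times: for the squares of the operators, for the derivatives of N, and for
    commuting D_b with d/dz^a. The rest is algebra with derivations at a point. Only J is assumed
    invertible. For N, the formula d/dwbar^c = N^b_c D_b applied to the conjugate of w^k gives (conj
    J - conj(dw/dzbar) phi) N = 1. In the same spirit, w o z = id gives J^-1 = dz/dw + phi
    conj(dz/dwbar). Both inverses are thus explicit in first derivatives and phi, which makes them
    smooth without any determinant. Local computations are made for abstract maps w, z between open
    sets satisfying [local_change]; two charts of one atlas and a chart of X paired with a chart of
    X_t are both instances. The bundle E enters by structural induction: if J satisfies D J = J P,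
    the product rule reduces the derivative of its tensor representation to the tangent case and its
    dual. Forms are families indexed by charts, so the comparison map has to choose a chart of X
    around each point; the cocycle laws collected in [gluing] remove the dependence on this
    choice. *)

Section CkCalculus.
Variable R : realType.
Implicit Types V W : normedModType R.

(** The difference [h = g - f] vanishes near [x], so the zero map satisfies the expansion that
    characterizes its differential, and [g = f + h] is a sum of differentiable maps. *)
Lemma near_eq_differentiable V W (f g : V -> W) x :
  (\near x, f x = g x) -> differentiable f x -> differentiable g x.
Proof.
move=> fg df.
pose h := g - f.
have gE : g = f + h by rewrite /h addrC subrK.
have dh : differentiable h x.
  have hx : h x = 0.
    by rewrite /h !fctE; have /= -> := nbhs_singleton fg; rewrite subrr.
  have nh : \forall y \near 0, h (y + x) = 0.
    have : \near x, h x = 0.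
      by apply: filterS fg => y; rewrite /h !fctE => ->; rewrite subrr.
    rewrite (near_shift 0 x); apply: filterS => y /=; by rewrite subr0.
  have h0 : h \o shift x = cst (h x) + (\0 : V -> W) +o_ 0 id.
    apply/eqaddoP => e e0; near=> y.
    have hy : h (y + x) = 0 by near: y.
    by rewrite /= !fctE hx hy addr0 subrr normr0 mulr_ge0// ltW.
  have c0 : continuous (\0 : V -> W) by exact: cst_continuous.
  have dE := diff_unique c0 h0.
  by apply/diff_locallyP; rewrite dE.
by rewrite gE; exact: differentiableD.
Unshelve. all: by end_near. Qed.

Lemma Ck_eq V W k (U : set V) (f g : V -> W) : open U ->
  (forall x, U x -> f x = g x) -> Ck k U f -> Ck k U g.
Proof.
move=> oU; elim: k f g => [|k IH] f g fg /=.
  move=> cf x Ux; have := cf x Ux; rewrite /prop_for /continuous_at -(fg _ Ux).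
  apply: cvg_trans; apply: near_eq_cvg; near=> y; apply: fg.
  by near: y; exact: open_nbhs_nbhs.
have nfg x : U x -> \near x, f x = g x.
  by move=> Ux; near=> y; apply: fg; near: y; exact: open_nbhs_nbhs.
move=> [df Df]; split.
  by move=> x Ux; apply: near_eq_differentiable (df x Ux); exact: nfg.
move=> v; apply: IH (Df v) => x Ux; apply: near_eq_derive; exact: nfg.
Unshelve. all: by end_near. Qed.

Lemma Ck_sub V W k (U U' : set V) (f : V -> W) :
  U `<=` U' -> Ck k U' f -> Ck k U f.
Proof.
move=> sU; elim: k f => [|k IH] f /=; first by move=> cf x /sU; exact: cf.
by case=> df Df; split => [x /sU|v]; [exact: df|exact: IH].
Qed.

(** [Ck] imposes, at each point of the set, conditions on the germ of the function there, so a
    different set may be used around each point. *)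
Lemma Ck_local V W k (U : set V) (f : V -> W) :
  (forall x, U x -> exists2 U' : set V, U' x & Ck k U' f) -> Ck k U f.
Proof.
elim: k f => [|k IH] f H /=.
  by move=> x /H[U' U'x C]; exact: C.
split; first by move=> x /H[U' U'x [C _]]; exact: C.
by move=> v; apply: IH => x /H[U' U'x [_ D]]; exists U' => //; exact: D.
Qed.

Lemma CkW V W k (U : set V) (f : V -> W) : Ck k.+1 U f -> Ck k U f.
Proof.
elim: k f => [|k IH] f.
  by move=> [df _] x Ux; exact/differentiable_continuous/df.
by move=> [df Df]; split => // v; exact/IH/Df.
Qed.

Lemma Ck_cst V W k (U : set V) (c : W) : Ck k U (cst c).
Proof.
elim: k c => [|k IH] c /=; first by move=> x _; exact: cst_continuous.
split => [x _|v]; first exact: differentiable_cst.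
rewrite (_ : (fun x => _) = cst 0); first exact: IH.
by apply/funext => x; rewrite derive_cst.
Qed.

Lemma CkD V W k (U : set V) (f g : V -> W) : open U ->
  Ck k U f -> Ck k U g -> Ck k U (f \+ g).
Proof.
move=> oU; elim: k f g => [|k IH] f g.
  by move=> cf cg x Ux; apply: continuousD; [exact: cf|exact: cg].
move=> [df Df] [dg Dg]; split.
  by move=> x Ux; apply: differentiableD; [exact: df|exact: dg].
move=> v; apply: (Ck_eq oU _ (IH _ _ (Df v) (Dg v))) => x Ux /=.
by rewrite -deriveD//; apply: diff_derivable; [exact: df|exact: dg].
Qed.

Lemma CkM V k (U : set V) (f g : V -> R^o) : open U ->
  Ck k U f -> Ck k U g -> Ck k U (fun x => f x * g x : R^o).
Proof.
move=> oU; elim: k f g => [|k IH] f g.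
  by move=> cf cg x Ux; apply: continuousM; [exact: cf|exact: cg].
(* In the product rule each factor also occurs undifferentiated, and the induction hypothesis wants
   it one order lower. *)
move=> Cf Cg; have Cf' := CkW Cf; have Cg' := CkW Cg.
case: Cf Cg => [df Df] [dg Dg]; split.
  by move=> x Ux; apply: differentiableM; [exact: df|exact: dg].
move=> v; have := CkD oU (IH _ _ Cf' (Dg v)) (IH _ _ Cg' (Df v)).
apply: (Ck_eq oU) => x Ux /=.
have -> : (fun y : V => f y * g y) = f * g by [].
by rewrite deriveM//; apply: diff_derivable; [exact: df|exact: dg].
Qed.

Lemma Ck_sum V W k (U : set V) (I : Type) (r : seq I) (f : I -> V -> W) : open U ->
  (forall i, Ck k U (f i)) -> Ck k U (fun x => \sum_(i <- r) f i x).
Proof.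
move=> oU Cf; elim: r => [|i r IH].
  rewrite (_ : (fun _ => _) = cst 0); first exact: Ck_cst.
  by apply/funext => x; rewrite big_nil.
rewrite (_ : (fun _ => _) = f i \+ (fun x => \sum_(i <- r) f i x)).
  exact: CkD.
by apply/funext => x; rewrite big_cons.
Qed.

(** Turns a directional derivative into a derivative in one real variable, to which the mean value
    theorem applies. *)
Lemma derivable_line V W (f : V -> W) (y u : V) (s : R) :
  derivable f (y + s *: u) u ->
  is_derive s 1 (fun s => f (y + s *: u)) ('D_u f (y + s *: u)).
Proof.
have E : (fun h : R => h^-1 *: (f (y + (h *: 1 + s) *: u) - f (y + s *: u))) =
   (fun h : R => h^-1 *: (f (h *: u + (y + s *: u)) - f (y + s *: u))).
  apply/funext => h; congr (_ *: (f _ - _)).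
  by rewrite scalerDl addrCA [h *: 1]mulr1.
move=> df; split; first by rewrite /derivable /= E.
by rewrite /derive /= E.
Qed.

End CkCalculus.

(** * Symmetry of second derivatives *)

Section Schwarz.
Variable R : realType.
Implicit Types V W : normedModType R.

Let subrACA_ (a b c d : R^o) : a - b - (c - d) = a - c - (b - d).
Proof. by rewrite !opprB addrACA [RHS]addrACA [- b - c]addrC. Qed.

(** Two applications of the mean value theorem: to the difference in direction [v], as a function of
    the step along [u], and then to its derivative, as a function of the step along [v]. *)
Lemma second_difference V (f : V -> R^o) (x u v : V) (s : R) : 0 < s ->
  (forall a b, a \in `[0, s] -> b \in `[0, s] ->
     differentiable f (x + a *: u + b *: v) /\
     differentiable ('D_u f) (x + a *: u + b *: v)) ->
  exists a b, [/\ a \in `[0, s], b \in `[0, s] &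
    f (x + s *: u + s *: v) - f (x + s *: u) - (f (x + s *: v) - f x) =
    'D_v ('D_u f) (x + a *: u + b *: v) * s * s].
Proof.
move=> s0 H.
have i0 : 0 \in `[0, s] by rewrite in_itv/= lexx ltW.
have is_ : s \in `[0, s] by rewrite in_itv/= lexx ltW.
pose g (a : R) : R := f ((x + s *: v) + a *: u) - f (x + a *: u).
have dg a : a \in `[0, s] ->
    is_derive a 1 g ('D_u f ((x + s *: v) + a *: u) - 'D_u f (x + a *: u)).
  move=> ai; rewrite /g; apply: is_deriveB; apply: derivable_line; apply: diff_derivable.
    by rewrite addrAC; case: (H a s ai is_).
  by case: (H a 0 ai i0); rewrite scale0r addr0.
have cg : {within `[0, s], continuous g}.
  by apply: derivable_within_continuous => a /dg [].
have [a ai Ea] := MVT s0 (fun a ai => dg a (subset_itv_oo_cc ai)) cg.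
have {}ai : a \in `[0, s] by exact: subset_itv_oo_cc.
pose k (b : R) : R := 'D_u f ((x + a *: u) + b *: v).
have dk b : b \in `[0, s] ->
    is_derive b 1 k ('D_v ('D_u f) ((x + a *: u) + b *: v)).
  move=> bi; rewrite /k; apply: derivable_line; apply: diff_derivable.
  by case: (H a b ai bi).
have ck : {within `[0, s], continuous k}.
  by apply: derivable_within_continuous => b /dk [].
have [b bi Eb] := MVT s0 (fun b bi => dk b (subset_itv_oo_cc bi)) ck.
exists a, b; split => //; first exact: subset_itv_oo_cc.
move: Ea Eb; rewrite /g /k !scale0r !addr0 subr0 => Ea Eb.
rewrite -Eb.
have -> : x + a *: u + s *: v = x + s *: v + a *: u by rewrite addrAC.
rewrite -[RHS]Ea.
have -> : x + s *: u + s *: v = x + s *: v + s *: u by rewrite addrAC.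
by [].
Qed.

(** The second difference is symmetric in [u] and [v]; read in both orders it equates the two mixed
    derivatives at points close to [x], and their continuity carries the equality to [x]. *)
Lemma derive_comm V (U : set V) (f : V -> R^o) (u v x : V) :
  open U -> U x -> Ck 2 U f -> 'D_v ('D_u f) x = 'D_u ('D_v f) x.
Proof.
move=> oU Ux [df Df].
have cont w w' : {for x, continuous ('D_w' ('D_w f) : V -> R^o)}.
  exact: ((Df w).2 w').
apply/eqP; rewrite -subr_eq0 -normr_le0; apply/ler_addgt0Pr => e e0.
rewrite add0r.
have e20 : 0 < e / 2 by rewrite divr_gt0.
have nearE : \forall y \near x, U y /\
    (`|'D_v ('D_u f) x - 'D_v ('D_u f) y| < e / 2 /\
     `|'D_u ('D_v f) x - 'D_u ('D_v f) y| < e / 2).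
  apply: filterI; first exact: open_nbhs_nbhs.
  by apply: filterI; [have /cvgrPdist_lt := cont u v|have /cvgrPdist_lt := cont v u]; exact.
have [d /= d0 Hd] : exists2 d : R, 0 < d & forall y, `|x - y| < d ->
    U y /\ (`|'D_v ('D_u f) x - 'D_v ('D_u f) y| < e / 2 /\
     `|'D_u ('D_v f) x - 'D_u ('D_v f) y| < e / 2).
  by move/nbhs_normP : nearE => [d d0 Hd]; exists d.
(* With this [s] the parallelogram spanned by [s *: u] and [s *: v] stays within d/2 of [x]; the
   summand 1 keeps the denominator positive when both directions vanish. *)
pose s := d / (`|u| + `|v| + 1) / 2.
have n0 : 0 < `|u| + `|v| + 1 by rewrite ltr_wpDl// addr_ge0.
have s0 : 0 < s by rewrite !divr_gt0.
have Hs a b : a \in `[0, s] -> b \in `[0, s] -> `|x - (x + a *: u + b *: v)| < d.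
  rewrite !in_itv /= => /andP[a0 as_] /andP[b0 bs].
  rewrite -addrA opprD addrA subrr add0r normrN.
  apply: le_lt_trans (ler_normD _ _) _; rewrite !normrZ !ger0_norm//.
  have h1 : a * `|u| + b * `|v| <= s * (`|u| + `|v| + 1).
    rewrite !mulrDr mulr1; apply: ler_wpDr; first exact: ltW.
    by apply: lerD; apply: ler_wpM2r.
  apply: le_lt_trans h1 _.
  by rewrite /s mulrAC divfK ?gt_eqF// ltr_pdivrMr// ltr_pMr// ltr1n.
have [a [b [ai bi E1]]] := @second_difference V f x u v s s0
  (fun a b ai bi => let Uab := (Hd _ (Hs a b ai bi)).1 in conj (df _ Uab) ((Df u).1 _ Uab)).
have Hs' a' b' : a' \in `[0, s] -> b' \in `[0, s] -> `|x - (x + a' *: v + b' *: u)| < d.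
  by move=> a'i b'i; rewrite addrAC; exact: Hs.
have [a' [b' [ai' bi' E2]]] := @second_difference V f x v u s s0
  (fun a b ai bi => let Uab := (Hd _ (Hs' a b ai bi)).1 in conj (df _ Uab) ((Df v).1 _ Uab)).
(* After regrouping, both expansions have the same left-hand side, and the factor [s * s]
   cancels. *)
have E : 'D_v ('D_u f) (x + a *: u + b *: v) = 'D_u ('D_v f) (x + a' *: v + b' *: u).
  have sn : (s : R) != 0 by rewrite gt_eqF.
  move: E1 E2; rewrite subrACA_ [x + s *: v + _]addrAC => -> E3.
  by move: E3 => /(mulIf sn) /(mulIf sn).
have [_ [h1 _]] := Hd _ (Hs _ _ ai bi).
have [_ [_ h2]] := Hd _ (Hs' _ _ ai' bi').
rewrite (splitr e); apply: ltW; apply: le_lt_trans (ltrD h1 h2).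
rewrite E [X in _ <= _ + X]distrC.
have := ler_normD ('D_v ('D_u f) x - 'D_u ('D_v f) (x + a' *: v + b' *: u))
  ('D_u ('D_v f) (x + a' *: v + b' *: u) - 'D_u ('D_v f) x).
by rewrite addrA subrK.
Qed.

End Schwarz.

(** * Matrix-valued maps and composition *)

Section Coordinates.
Variable R : realType.
Implicit Types V W : normedModType R.

Lemma derivable_coord V (m1 m2 : nat) (f : V -> 'M[R]_(m1, m2)) x v r c :
  derivable f x v -> 'D_v (fun y => f y r c : R^o) x = ('D_v f x) r c.
Proof. by move=> df; rewrite (derive_mx df) mxE. Qed.

Lemma Ck_coord V (m1 m2 : nat) k (U : set V) (f : V -> 'M[R]_(m1, m2)) r c :
  open U -> Ck k U f -> Ck k U (fun x => f x r c : R^o).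
Proof.
move=> oU; elim: k f => [|k IH] f.
  move=> cf x Ux; apply: (@continuous_comp _ _ _ f (fun M : 'M[R]_(m1, m2) => M r c : R^o)).
    exact: cf.
  exact: coord_continuous.
move=> [df Df]; split.
  move=> x Ux; apply: (@differentiable_comp _ _ _ _ f (fun M : 'M[R]_(m1, m2) => M r c : R^o)).
    exact: df.
  exact: differentiable_coord.
move=> v; apply: (Ck_eq oU _ (IH _ (Df v))) => x Ux /=.
by rewrite derivable_coord//; exact/diff_derivable/df.
Qed.

Lemma CkZl V W k (U : set V) (h : V -> R^o) (c : W) : open U ->
  Ck k U h -> Ck k U (fun x => h x *: c).
Proof.
move=> oU; elim: k h => [|k IH] h.
  by move=> ch x Ux; apply: cvgZr_tmp; exact: ch.
move=> [dh Dh]; split.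
  by move=> x Ux; apply: differentiableZl; exact: dh.
move=> v; apply: (Ck_eq oU _ (IH _ (Dh v))) => x Ux /=.
have dx := dh x Ux.
rewrite !deriveE//; last exact: differentiableZl.
by rewrite diffZl.
Qed.

Lemma Ck_mx V (m1 m2 : nat) k (U : set V) (f : V -> 'M[R]_(m1, m2)) :
  open U -> (forall r c, Ck k U (fun x => f x r c : R^o)) -> Ck k U f.
Proof.
move=> oU Cf.
rewrite (_ : f = fun x => \sum_r \sum_c (f x r c : R^o) *: (delta_mx r c : 'M[R]_(m1, m2))).
  by do 2!(apply: Ck_sum => // ?); exact: CkZl.
by apply/funext => x; rewrite {1}[f x]matrix_sum_delta.
Qed.

Lemma derive_comp_mx V W (m1 m2 : nat) (f : V -> 'M[R]_(m1, m2))
    (g : 'M[R]_(m1, m2) -> W) x v :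
  differentiable f x -> differentiable g (f x) ->
  'D_v (g \o f) x = 'D_('D_v f x) g (f x).
Proof.
move=> df dg; rewrite !deriveE//; last exact: differentiable_comp.
by rewrite diff_comp.
Qed.

Lemma derive_delta W (m1 m2 : nat) (g : 'M[R]_(m1, m2) -> W) x v :
  differentiable g x ->
  'D_v g x = \sum_r \sum_c v r c *: 'D_(delta_mx r c) g x.
Proof.
move=> dg; rewrite deriveE// [in LHS](matrix_sum_delta v) linear_sum.
apply: eq_bigr => r _; rewrite linear_sum; apply: eq_bigr => c _.
by rewrite linearZ deriveE.
Qed.

(** The chain rule differentiates [g] in the moving direction ['D_v f x]. Expanding it over the
    elementary matrices leaves derivatives of [g] in fixed directions, composed with [f], and to
    these the induction hypothesis applies. *)
Lemma Ck_comp V (m1 m2 : nat) k (U : set V) (U' : set 'M[R]_(m1, m2))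
    (f : V -> 'M[R]_(m1, m2)) (g : 'M[R]_(m1, m2) -> R^o) :
  open U -> (forall x, U x -> U' (f x)) ->
  Ck k U f -> Ck k U' g -> Ck k U (fun x => g (f x) : R^o).
Proof.
move=> oU fU; elim: k f g fU => [|k IH] f g fU Cf Cg.
  move=> x Ux; apply: (@continuous_comp _ _ _ f g); first exact: Cf.
  exact/Cg/fU.
have Cf' := CkW Cf; case: Cf Cg => [df Df] [dg Dg]; split.
  move=> x Ux; apply: (@differentiable_comp _ _ _ _ f g); first exact: df.
  exact/dg/fU.
move=> v; apply: (@Ck_eq _ _ _ _ _ (fun x => \sum_r \sum_c
    (('D_v f x r c : R^o) * ('D_(delta_mx r c) g (f x) : R^o)) : R^o) _ oU).
  move=> x Ux.
  have -> : 'D_v (fun x => g (f x)) x = 'D_('D_v f x) g (f x).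
    by apply: derive_comp_mx; [exact: df|exact/dg/fU].
  by rewrite (derive_delta _ (dg _ (fU _ Ux))).
do 2!(apply: Ck_sum => // ?); apply: CkM => //; first exact: Ck_coord (Df v).
exact: IH (Dg _).
Qed.

End Coordinates.

(** * Complex-valued functions and Wirtinger derivatives *)

Section ComplexValued.
Variables (R : realType) (n : nat).
Implicit Types (U : set (Cn R n)) (f g : Cn R n -> Cplx R) (p v : Cn R n).

Lemma complex_ReM (x y : Cplx R) : complex.Re (x * y) =
  complex.Re x * complex.Re y - complex.Im x * complex.Im y.
Proof. by case: x; case: y. Qed.

Lemma complex_ImM (x y : Cplx R) : complex.Im (x * y) =
  complex.Re x * complex.Im y + complex.Im x * complex.Re y.
Proof. by case: x; case: y. Qed.

Lemma complex_ReD (x y : Cplx R) : complex.Re (x + y) = complex.Re x + complex.Re y.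
Proof. by case: x; case: y. Qed.

Lemma complex_ImD (x y : Cplx R) : complex.Im (x + y) = complex.Im x + complex.Im y.
Proof. by case: x; case: y. Qed.

Lemma complex_ReJ (x : Cplx R) : complex.Re x^* = complex.Re x.
Proof. by case: x. Qed.

Lemma complex_ImJ (x : Cplx R) : complex.Im x^* = - complex.Im x.
Proof. by case: x. Qed.

Lemma iE : 'i = Complex 0 1 :> Cplx R.
Proof. by []. Qed.

Lemma complex_ReIm (x : Cplx R) : x = Complex (complex.Re x) (complex.Im x).
Proof. by case: x. Qed.

Lemma smoothC_eq U f g : open U -> (forall x, U x -> f x = g x) ->
  smoothC_on U f -> smoothC_on U g.
Proof.
by move=> oU fg [Rf If]; split=> k; [move: (Rf k)|move: (If k)];
  apply: Ck_eq => // x /fg ->.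
Qed.

Lemma smoothC_sub U U' f : U `<=` U' -> smoothC_on U' f -> smoothC_on U f.
Proof. by move=> sU [Rf If]; split=> k; apply: Ck_sub (sU) _. Qed.

Lemma smoothC_local U f :
  (forall x, U x -> exists2 U', U' x & smoothC_on U' f) -> smoothC_on U f.
Proof.
by move=> H; split=> k; apply: Ck_local => x /H[U' U'x [Rf If]]; exists U'.
Qed.

Lemma smoothC_cst U c : smoothC_on U (fun=> c).
Proof. by split=> k; exact: Ck_cst. Qed.

Lemma smoothC_conj U f : open U -> smoothC_on U f -> smoothC_on U (fun x => (f x)^*).
Proof.
move=> oU [Rf If]; split=> k.
  by move: (Rf k); apply: Ck_eq => // x _; rewrite complex_ReJ.
have C := CkM oU (@Ck_cst _ (Cn R n) R^o k U (-1 : R^o)) (If k).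
by move: C; apply: Ck_eq => // x _; rewrite complex_ImJ mulN1r.
Qed.

Lemma smoothCD U f g : open U -> smoothC_on U f -> smoothC_on U g ->
  smoothC_on U (fun x => f x + g x).
Proof.
move=> oU [Rf If] [Rg Ig]; split=> k.
  by have := CkD oU (Rf k) (Rg k); apply: Ck_eq => // x _; rewrite complex_ReD.
by have := CkD oU (If k) (Ig k); apply: Ck_eq => // x _; rewrite complex_ImD.
Qed.

Lemma smoothCM U f g : open U -> smoothC_on U f -> smoothC_on U g ->
  smoothC_on U (fun x => f x * g x).
Proof.
move=> oU [Rf If] [Rg Ig]; split=> k.
  have C := CkM oU (@Ck_cst _ (Cn R n) R^o k U (-1 : R^o)) (CkM oU (If k) (Ig k)).
  have := CkD oU (CkM oU (Rf k) (Rg k)) C.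
  by apply: Ck_eq => // x _; rewrite complex_ReM /= mulN1r.
have := CkD oU (CkM oU (Rf k) (Ig k)) (CkM oU (If k) (Rg k)).
by apply: Ck_eq => // x _; rewrite complex_ImM.
Qed.

Lemma smoothCN U f : open U -> smoothC_on U f -> smoothC_on U (fun x => - f x).
Proof.
move=> oU sf; have := smoothCM oU (@smoothC_cst U (-1)) sf.
by apply: smoothC_eq => // x _; rewrite mulN1r.
Qed.

Lemma smoothCB U f g : open U -> smoothC_on U f -> smoothC_on U g ->
  smoothC_on U (fun x => f x - g x).
Proof. by move=> oU sf sg; apply: smoothCD => //; exact: smoothCN. Qed.

Lemma smoothC_sum U (I : Type) (r : seq I) (P : pred I) (F : I -> Cn R n -> Cplx R) :
  open U -> (forall i, P i -> smoothC_on U (F i)) ->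
  smoothC_on U (fun x => \sum_(i <- r | P i) F i x).
Proof.
move=> oU sF; elim: r => [|i r IH].
  by have := @smoothC_cst U 0; apply: smoothC_eq => // x _; rewrite big_nil.
case: (boolP (P i)) => Pi.
  have := smoothCD oU (sF i Pi) IH.
  by apply: smoothC_eq => // x _; rewrite big_cons Pi.
by move: IH; apply: smoothC_eq => // x _; rewrite big_cons (negbTE Pi).
Qed.

Lemma smoothC_prod U (I : Type) (r : seq I) (P : pred I) (F : I -> Cn R n -> Cplx R) :
  open U -> (forall i, P i -> smoothC_on U (F i)) ->
  smoothC_on U (fun x => \prod_(i <- r | P i) F i x).
Proof.
move=> oU sF; elim: r => [|i r IH].
  by have := @smoothC_cst U 1; apply: smoothC_eq => // x _; rewrite big_nil.
case: (boolP (P i)) => Pi.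
  have := smoothCM oU (sF i Pi) IH.
  by apply: smoothC_eq => // x _; rewrite big_cons Pi.
by move: IH; apply: smoothC_eq => // x _; rewrite big_cons (negbTE Pi).
Qed.

Lemma smoothC_dirC U f v : smoothC_on U f -> smoothC_on U (dirC f v).
Proof.
by move=> [Rf If]; split=> k; [have [_] := Rf k.+1|have [_] := If k.+1]; exact.
Qed.

Lemma smoothC_dz U f a : open U -> smoothC_on U f -> smoothC_on U (dz a f).
Proof.
move=> oU sf; rewrite /dz; apply: smoothCM => //; first exact: smoothC_cst.
apply: smoothCB => //; first exact: smoothC_dirC.
by apply: smoothCM => //; [exact: smoothC_cst|exact: smoothC_dirC].
Qed.

Lemma smoothC_dzbar U f a : open U -> smoothC_on U f -> smoothC_on U (dzbar a f).
Proof.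
move=> oU sf; rewrite /dzbar; apply: smoothCM => //; first exact: smoothC_cst.
apply: smoothCD => //; first exact: smoothC_dirC.
by apply: smoothCM => //; [exact: smoothC_cst|exact: smoothC_dirC].
Qed.

Lemma smoothC_coord U m (h : Cn R n -> Cn R m) c : open U -> smooth_on U h ->
  smoothC_on U (coord c \o h).
Proof. by move=> oU sh; split=> k; exact: (Ck_coord _ _ oU (sh k)). Qed.

Lemma smoothC_comp U m (U' : set (Cn R m)) (h : Cn R n -> Cn R m)
    (g : Cn R m -> Cplx R) :
  open U -> (forall x, U x -> U' (h x)) -> smooth_on U h -> smoothC_on U' g ->
  smoothC_on U (fun x => g (h x)).
Proof.
move=> oU hU sh [Rg Ig]; split=> k.
  exact: (Ck_comp oU hU (sh k) (Rg k)).
exact: (Ck_comp oU hU (sh k) (Ig k)).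
Qed.

Lemma smoothC_derivable U f p v : smoothC_on U f -> U p ->
  derivable (fun y => complex.Re (f y) : R^o) p v /\
  derivable (fun y => complex.Im (f y) : R^o) p v.
Proof.
move=> [Rf If] Up; split; apply: diff_derivable; [have [] := Rf 1|have [] := If 1];
  by move=> + _; exact.
Qed.

Lemma dirC_comm U f p u v : open U -> U p -> smoothC_on U f ->
  dirC (dirC f u) v p = dirC (dirC f v) u p.
Proof.
move=> oU Up [Rf If].
exact: (f_equal2 (@Complex R) (derive_comm u v oU Up (Rf 2))
                              (derive_comm u v oU Up (If 2))).
Qed.

(** A common interface for [dirC], [dz], [dzbar] and [twisted_dbar] at a point, so that the rules
    for sums, products and tensor representations are proved once. Functions are total, and [der_eq]
    records that only their values on [U] count. *)
Record derivation U p (D : (Cn R n -> Cplx R) -> Cplx R) : Prop := Derivation {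
  der_eq : forall f g, (forall x, U x -> f x = g x) -> D f = D g;
  der_cst : forall c, D (fun=> c) = 0;
  derD : forall f g, smoothC_on U f -> smoothC_on U g ->
    D (fun x => f x + g x) = D f + D g;
  derM : forall f g, smoothC_on U f -> smoothC_on U g ->
    D (fun x => f x * g x) = D f * g p + f p * D g }.

Let Re_leibniz (a b c d a' b' c' d' : R) :
  a * c' + c * a' - (b * d' + d * b') = a' * c - b' * d + (a * c' - b * d').
Proof. ring. Qed.

Let Im_leibniz (a b c d a' b' c' d' : R) :
  a * d' + d * a' + (b * c' + c * b') = a' * d + b' * c + (a * d' + b * c').
Proof. ring. Qed.

Lemma derivation_dirC U p v : open U -> U p ->
  derivation U p (fun f => dirC f v p).
Proof.
move=> oU Up; split.
- move=> f g fg; have nU : nbhs p U by exact: open_nbhs_nbhs.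
  by congr Complex; apply: near_eq_derive; apply: filterS nU => x /fg ->.
- by move=> c; rewrite /dirC /= !derive_cst.
- move=> f g sf sg.
  have [Rf If] := smoothC_derivable v sf Up.
  have [Rg Ig] := smoothC_derivable v sg Up.
  refine (f_equal2 (@Complex R) (etrans _ (deriveD Rf Rg)) (etrans _ (deriveD If Ig))).
    by congr (derive _ p v); apply/funext => x; rewrite complex_ReD.
  by congr (derive _ p v); apply/funext => x; rewrite complex_ImD.
- move=> f g sf sg.
  have [Rf If] := smoothC_derivable v sf Up.
  have [Rg Ig] := smoothC_derivable v sg Up.
  have reE : derive (fun x => complex.Re (f x * g x) : R^o) p v =
      complex.Re (dirC f v p * g p + f p * dirC g v p).
    rewrite complex_ReD !complex_ReM.
    have := deriveB (derivableM Rf Rg) (derivableM If Ig).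
    rewrite (deriveM Rf Rg) (deriveM If Ig) => E.
    rewrite (_ : (fun x => _) =
      (fun y => complex.Re (f y) : R^o) * (fun y => complex.Re (g y) : R^o)
      - (fun y => complex.Im (f y) : R^o) * (fun y => complex.Im (g y) : R^o)).
      by rewrite E; exact: Re_leibniz.
    by apply/funext => x; rewrite complex_ReM.
  have imE : derive (fun x => complex.Im (f x * g x) : R^o) p v =
      complex.Im (dirC f v p * g p + f p * dirC g v p).
    rewrite complex_ImD !complex_ImM.
    have := deriveD (derivableM Rf Ig) (derivableM If Rg).
    rewrite (deriveM Rf Ig) (deriveM If Rg) => E.
    rewrite (_ : (fun x => _) =
      (fun y => complex.Re (f y) : R^o) * (fun y => complex.Im (g y) : R^o)
      + (fun y => complex.Im (f y) : R^o) * (fun y => complex.Re (g y) : R^o)).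
      by rewrite E; exact: Im_leibniz.
    by apply/funext => x; rewrite complex_ImM.
  by rewrite [RHS]complex_ReIm -reE -imE.
Qed.

Lemma derivation_comb U p D1 D2 (c1 c2 : Cplx R) :
  derivation U p D1 -> derivation U p D2 ->
  derivation U p (fun f => c1 * D1 f + c2 * D2 f).
Proof.
move=> d1 d2; split.
- by move=> f g fg; rewrite (der_eq d1 fg) (der_eq d2 fg).
- by move=> c; rewrite (der_cst d1) (der_cst d2) !mulr0 addr0.
- by move=> f g sf sg; rewrite (derD d1)// (derD d2)// !mulrDr addrACA.
- by move=> f g sf sg; rewrite (derM d1)// (derM d2)//; ring.
Qed.

Lemma derivation_sum U p (I : Type) (r : seq I) (P : pred I) D (c : I -> Cplx R) :
  (forall i, derivation U p (D i)) ->
  derivation U p (fun f => \sum_(i <- r | P i) c i * D i f).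
Proof.
move=> d; split.
- by move=> f g fg; apply: eq_bigr => i _; rewrite (der_eq (d i) fg).
- by move=> c0; apply: big1 => i _; rewrite (der_cst (d i)) mulr0.
- move=> f g sf sg; rewrite -big_split; apply: eq_bigr => i _ /=.
  by rewrite (derD (d i))// mulrDr.
- move=> f g sf sg; rewrite mulr_suml mulr_sumr -big_split.
  by apply: eq_bigr => i _ /=; rewrite (derM (d i))//; ring.
Qed.

Lemma derivation_dz U p a : open U -> U p -> derivation U p (fun f => dz a f p).
Proof.
move=> oU Up.
have := derivation_comb (2^-1) (- (2^-1 * 'i))
  (derivation_dirC (dx R a) oU Up) (derivation_dirC (dy R a) oU Up).
congr (derivation _ _ _); apply/funext => f.
by rewrite /dz mulrBr mulNr mulrA.
Qed.

Lemma derivation_dzbar U p a : open U -> U p -> derivation U p (fun f => dzbar a f p).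
Proof.
move=> oU Up.
have := derivation_comb (2^-1) (2^-1 * 'i)
  (derivation_dirC (dx R a) oU Up) (derivation_dirC (dy R a) oU Up).
congr (derivation _ _ _); apply/funext => f.
by rewrite /dzbar mulrDr mulrA.
Qed.

Section DerivationTheory.
Variables (U : set (Cn R n)) (p : Cn R n) (D : (Cn R n -> Cplx R) -> Cplx R).
Hypotheses (oU : open U) (dD : derivation U p D).

Lemma der_scale c f : smoothC_on U f -> D (fun x => c * f x) = c * D f.
Proof.
move=> sf; rewrite (derM dD)//; last exact: smoothC_cst.
by rewrite (der_cst dD) mul0r add0r.
Qed.

Lemma derN f : smoothC_on U f -> D (fun x => - f x) = - D f.
Proof.
move=> sf; rewrite -mulN1r -der_scale//; apply: (der_eq dD) => x _.
by rewrite mulN1r.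
Qed.

Lemma derB f g : smoothC_on U f -> smoothC_on U g ->
  D (fun x => f x - g x) = D f - D g.
Proof.
by move=> sf sg; rewrite (derD dD)//; [rewrite derN|exact: smoothCN].
Qed.

Lemma der_sum (I : Type) (r : seq I) (P : pred I) (F : I -> Cn R n -> Cplx R) :
  (forall i, P i -> smoothC_on U (F i)) ->
  D (fun x => \sum_(i <- r | P i) F i x) = \sum_(i <- r | P i) D (F i).
Proof.
move=> sF; elim: r => [|i r IH].
  rewrite big_nil; apply: etrans (der_cst dD 0); congr D; apply/funext => x.
  by rewrite big_nil.
rewrite big_cons; case: (boolP (P i)) => Pi.
  rewrite -IH -(derD dD); [|exact: sF|exact: smoothC_sum].
  by congr D; apply/funext => x; rewrite big_cons Pi.
by rewrite -IH; congr D; apply/funext => x; rewrite big_cons (negbTE Pi).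
Qed.

Lemma der_prod (I : finType) (F : I -> Cn R n -> Cplx R) :
  (forall i, smoothC_on U (F i)) ->
  D (fun x => \prod_i F i x) =
  \sum_i D (F i) * \prod_(j | j != i) F j p.
Proof.
move=> sF.
suff H (r : seq I) : uniq r -> D (fun x => \prod_(i <- r) F i x) =
    \sum_(i <- r) D (F i) * \prod_(j <- r | j != i) F j p.
  by have := H _ (index_enum_uniq I).
elim: r => [_|i r IH /= /andP[ir ur]].
  rewrite big_nil; apply: etrans (der_cst dD 1); congr D; apply/funext => x.
  by rewrite big_nil.
have -> : (fun x => \prod_(j <- i :: r) F j x) = (fun x => F i x * \prod_(j <- r) F j x).
  by apply/funext => x; rewrite big_cons.
rewrite (derM dD)//; last exact: smoothC_prod.
rewrite big_cons big_cons eqxx /=; congr (D _ * _ + _).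
  rewrite big_seq_cond [RHS]big_seq_cond; apply: eq_bigl => j.
  by case: (boolP (j \in r)) => //= jr; apply/esym; apply: contraNneq ir => <-.
rewrite IH// mulr_sumr big_seq [RHS]big_seq; apply: eq_bigr => j jr.
rewrite [in RHS]big_cons ifT; first by rewrite mulrCA.
by apply: contraNneq ir => ->.
Qed.

End DerivationTheory.
End ComplexValued.

Section Wirtinger.
Variables (R : realType) (n : nat).
Implicit Types (U : set (Cn R n)) (f g : Cn R n -> Cplx R) (p v : Cn R n).

Lemma complex_mulE (a b c d : R) :
  (Complex a b : Cplx R) * Complex c d = Complex (a * c - b * d) (a * d + b * c).
Proof. by []. Qed.

Lemma complex_addE (a b c d : R) :
  (Complex a b : Cplx R) + Complex c d = Complex (a + c) (b + d).
Proof. by []. Qed.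

Lemma complex_oppE (a b : R) : - (Complex a b : Cplx R) = Complex (- a) (- b).
Proof. by []. Qed.

Lemma Re_sum (I : Type) (r : seq I) (P : pred I) (F : I -> Cplx R) :
  complex.Re (\sum_(i <- r | P i) F i) = \sum_(i <- r | P i) complex.Re (F i).
Proof. exact: (big_morph _ (@complex_ReD R)). Qed.

Lemma Im_sum (I : Type) (r : seq I) (P : pred I) (F : I -> Cplx R) :
  complex.Im (\sum_(i <- r | P i) F i) = \sum_(i <- r | P i) complex.Im (F i).
Proof. exact: (big_morph _ (@complex_ImD R)). Qed.

Lemma coord_dx (a c : 'I_n) : coord c (dx R a) = (c == a)%:R.
Proof.
rewrite /coord /dx !mxE /=; by case: (c == a).
Qed.

Lemma coord_dy (a c : 'I_n) : coord c (dy R a) = 'i * (c == a)%:R.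
Proof.
rewrite /coord /dy !mxE /=; case: (c == a); last by rewrite mulr0.
by rewrite mulr1 iE.
Qed.

Lemma dirC_conj U f p v : U p -> smoothC_on U f ->
  dirC (fun x => (f x)^*) v p = (dirC f v p)^*.
Proof.
move=> Up sf; have [Rf If] := smoothC_derivable v sf Up.
refine (f_equal2 (@Complex R) _ (etrans _ (deriveN If))).
  by congr (derive _ p v); apply/funext => x; rewrite complex_ReJ.
by congr (derive _ p v); apply/funext => x; rewrite complex_ImJ.
Qed.

Lemma conj_half : ((2 : Cplx R)^-1)^* = 2^-1.
Proof. by rewrite rmorphV ?unitfE ?pnatr_eq0// rmorph_nat. Qed.

Lemma conj_i : ('i : Cplx R)^* = - 'i.
Proof. exact: conjCi. Qed.

Lemma dz_conj U f p a : U p -> smoothC_on U f ->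
  dz a (fun x => (f x)^*) p = (dzbar a f p)^*.
Proof.
move=> Up sf; rewrite /dz /dzbar !(dirC_conj _ Up sf).
by rewrite rmorphM rmorphD rmorphM /= conj_half conj_i mulNr.
Qed.

Lemma dzbar_conj U f p a : U p -> smoothC_on U f ->
  dzbar a (fun x => (f x)^*) p = (dz a f p)^*.
Proof.
move=> Up sf; rewrite /dz /dzbar !(dirC_conj _ Up sf).
by rewrite rmorphM rmorphB rmorphM /= conj_half conj_i mulNr opprK.
Qed.

Lemma dirC_coord c p v : dirC (@coord R n c) v p = coord c v.
Proof.
have E r : derive (fun y : Cn R n => y r c : R^o) p v = v r c.
  by rewrite (derivable_coord r c (@derivable_id R (Cn R n) p v)) derive_id.
exact: f_equal2 (E ord0) (E ord_max).
Qed.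

Lemma dz_coord a c p : dz a (@coord R n c) p = (c == a)%:R.
Proof.
rewrite /dz !dirC_coord coord_dx coord_dy mulrA -expr2 sqrCi mulN1r opprK.
by rewrite -mulr2n -(mulr_natl _%:R) mulKf ?pnatr_eq0.
Qed.

Lemma dzbar_coord a c p : dzbar a (@coord R n c) p = 0.
Proof.
rewrite /dzbar !dirC_coord coord_dx coord_dy mulrA -expr2 sqrCi mulN1r.
by rewrite subrr mulr0.
Qed.

(** Real linearity expands the derivative over [dx] and [dy]; then d/dx = d/dz + d/dzbar and d/dy =
    i (d/dz - d/dzbar). *)
Lemma dirC_direction U f p v : U p -> smoothC_on U f ->
  dirC f v p = \sum_a (coord a v * dz a f p + (coord a v)^* * dzbar a f p).
Proof.
move=> Up sf.
have [dR dI] : differentiable (fun y => complex.Re (f y) : R^o) p /\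
               differentiable (fun y => complex.Im (f y) : R^o) p.
  by case: sf => Rf If; split; [have [] := Rf 1|have [] := If 1]; move=> + _; exact.
have E : dirC f v p = \sum_a ((Complex (v ord0 a) 0 : Cplx R) * dirC f (dx R a) p
                      + (Complex (v ord_max a) 0 : Cplx R) * dirC f (dy R a) p).
  rewrite [RHS]complex_ReIm Re_sum Im_sum.
  have split_sum (F : 'I_2 -> 'I_n -> R) :
      \sum_r \sum_c F r c = \sum_c (F ord0 c + F ord_max c).
    rewrite !big_ord_recl big_ord0 addr0 -big_split /=.
    by have -> : lift ord0 ord0 = ord_max :> 'I_2 by apply/val_inj.
  refine (f_equal2 (@Complex R) _ _).
    rewrite (derive_delta v dR) split_sum; apply: eq_bigr => a _.
    by rewrite complex_ReD !complex_ReM /= !mul0r !subr0.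
  rewrite (derive_delta v dI) split_sum; apply: eq_bigr => a _.
  by rewrite complex_ImD !complex_ImM /= !mul0r !addr0.
rewrite E; apply: eq_bigr => a _; rewrite /dz /dzbar.
set A := dirC f (dx R a) p; set B := dirC f (dy R a) p.
have -> : (coord a v)^* = Complex (v ord0 a) 0 - 'i * Complex (v ord_max a) 0.
  rewrite /coord iE complex_mulE complex_oppE complex_addE.
  by refine (f_equal2 (@Complex R) _ _); ring.
have -> : coord a v = Complex (v ord0 a) 0 + 'i * Complex (v ord_max a) 0.
  rewrite /coord iE complex_mulE complex_addE.
  by refine (f_equal2 (@Complex R) _ _); ring.
have i2 : 'i * 'i = -1 :> Cplx R by rewrite -expr2 sqrCi.
move: (Complex (v ord0 a) 0 : Cplx R) (Complex (v ord_max a) 0 : Cplx R) A B => x y A B.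
by rewrite [RHS](_ : _ = x * A - ('i * 'i) * (y * B)); [rewrite i2 mulN1r opprK|field].
Qed.

End Wirtinger.

(** * Chain rule and commutation for Wirtinger derivatives *)

Section WirtingerChain.
Variables (R : realType) (n : nat).
Implicit Types (U : set (Cn R n)) (f g : Cn R n -> Cplx R) (p v : Cn R n).

Lemma dirC_comp m U (U' : set (Cn R m)) (h : Cn R n -> Cn R m)
    (g : Cn R m -> Cplx R) p v :
  U p -> U' (h p) -> smooth_on U h -> smoothC_on U' g ->
  dirC (fun x => g (h x)) v p =
    \sum_b (dirC (coord b \o h) v p * dz b g (h p) +
            (dirC (coord b \o h) v p)^* * dzbar b g (h p)).
Proof.
move=> Up U'p sh sg.
have dh : differentiable h p by case: (sh 1) => + _; exact.
have [dR dI] : differentiable (fun y => complex.Re (g y) : R^o) (h p) /\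
               differentiable (fun y => complex.Im (g y) : R^o) (h p).
  by case: sg => Rg Ig; split; [have [] := Rg 1|have [] := Ig 1]; move=> + _; exact.
have E : dirC (fun x => g (h x)) v p = dirC g ('D_v h p) (h p).
  exact: (f_equal2 (@Complex R) (derive_comp_mx v dh dR) (derive_comp_mx v dh dI)).
rewrite E (dirC_direction _ U'p sg); apply: eq_bigr => b _.
have -> // : dirC (coord b \o h) v p = coord b ('D_v h p).
have dhv : derivable h p v by exact: diff_derivable.
exact: (f_equal2 (@Complex R) (derivable_coord ord0 b dhv) (derivable_coord ord_max b dhv)).
Qed.

Let dz_chain (x y d e : Cplx R) :
  2^-1 * ((x * d + x^* * e) - 'i * (y * d + y^* * e)) =
  2^-1 * (x - 'i * y) * d + (2^-1 * (x + 'i * y))^* * e.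
Proof. by rewrite rmorphM rmorphD rmorphM /= conj_half conj_i; ring. Qed.

Let dzbar_chain (x y d e : Cplx R) :
  2^-1 * ((x * d + x^* * e) + 'i * (y * d + y^* * e)) =
  2^-1 * (x + 'i * y) * d + (2^-1 * (x - 'i * y))^* * e.
Proof. by rewrite rmorphM rmorphB rmorphM /= conj_half conj_i; ring. Qed.

Lemma dz_comp m U (U' : set (Cn R m)) (h : Cn R n -> Cn R m)
    (g : Cn R m -> Cplx R) p a :
  U p -> U' (h p) -> smooth_on U h -> smoothC_on U' g ->
  dz a (fun x => g (h x)) p =
    \sum_b (dz a (coord b \o h) p * dz b g (h p) +
            (dzbar a (coord b \o h) p)^* * dzbar b g (h p)).
Proof.
move=> Up U'p sh sg; rewrite {1}/dz !(dirC_comp _ Up U'p sh sg).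
rewrite mulr_sumr -sumrB mulr_sumr; apply: eq_bigr => b _.
exact: dz_chain.
Qed.

Lemma dzbar_comp m U (U' : set (Cn R m)) (h : Cn R n -> Cn R m)
    (g : Cn R m -> Cplx R) p a :
  U p -> U' (h p) -> smooth_on U h -> smoothC_on U' g ->
  dzbar a (fun x => g (h x)) p =
    \sum_b (dzbar a (coord b \o h) p * dz b g (h p) +
            (dz a (coord b \o h) p)^* * dzbar b g (h p)).
Proof.
move=> Up U'p sh sg; rewrite {1}/dzbar !(dirC_comp _ Up U'p sh sg).
rewrite mulr_sumr -big_split mulr_sumr; apply: eq_bigr => b _ /=.
exact: dzbar_chain.
Qed.

Section Commute.
Variables (U : set (Cn R n)) (p : Cn R n) (f : Cn R n -> Cplx R).
Hypotheses (oU : open U) (Up : U p) (sf : smoothC_on U f).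

Lemma dz_dirC a v : dz a (dirC f v) p = dirC (dz a f) v p.
Proof.
have dD := derivation_dirC v oU Up.
have sx := smoothC_dirC (dx R a) sf; have sy := smoothC_dirC (dy R a) sf.
rewrite {2}/dz (der_scale dD); last first.
  by apply: smoothCB => //; apply: smoothCM => //; exact: smoothC_cst.
rewrite (derB oU dD)//; last by apply: smoothCM => //; exact: smoothC_cst.
by rewrite (der_scale dD 'i sy) /dz (dirC_comm v (dx R a) oU Up sf)
  (dirC_comm v (dy R a) oU Up sf).
Qed.

Lemma dzbar_dirC a v : dzbar a (dirC f v) p = dirC (dzbar a f) v p.
Proof.
have dD := derivation_dirC v oU Up.
have sx := smoothC_dirC (dx R a) sf; have sy := smoothC_dirC (dy R a) sf.
rewrite {2}/dzbar (der_scale dD); last first.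
  by apply: smoothCD => //; apply: smoothCM => //; exact: smoothC_cst.
rewrite (derD dD)//; last by apply: smoothCM => //; exact: smoothC_cst.
by rewrite (der_scale dD 'i sy) /dzbar (dirC_comm v (dx R a) oU Up sf)
  (dirC_comm v (dy R a) oU Up sf).
Qed.

Lemma dz_comm a b : dz a (dz b f) p = dz b (dz a f) p.
Proof.
have dD := derivation_dz a oU Up.
have sx := smoothC_dirC (dx R b) sf; have sy := smoothC_dirC (dy R b) sf.
rewrite {2}/dz (der_scale dD); last first.
  by apply: smoothCB => //; apply: smoothCM => //; exact: smoothC_cst.
rewrite (derB oU dD)//; last by apply: smoothCM => //; exact: smoothC_cst.
by rewrite (der_scale dD 'i sy) (dz_dirC a (dx R b)) (dz_dirC a (dy R b)).
Qed.

Lemma dzbar_comm a b : dzbar a (dzbar b f) p = dzbar b (dzbar a f) p.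
Proof.
have dD := derivation_dzbar a oU Up.
have sx := smoothC_dirC (dx R b) sf; have sy := smoothC_dirC (dy R b) sf.
rewrite {2}/dzbar (der_scale dD); last first.
  by apply: smoothCD => //; apply: smoothCM => //; exact: smoothC_cst.
rewrite (derD dD)//; last by apply: smoothCM => //; exact: smoothC_cst.
by rewrite (der_scale dD 'i sy) (dzbar_dirC a (dx R b)) (dzbar_dirC a (dy R b)).
Qed.

Lemma dz_dzbar_comm a b : dz a (dzbar b f) p = dzbar b (dz a f) p.
Proof.
have dD := derivation_dz a oU Up.
have sx := smoothC_dirC (dx R b) sf; have sy := smoothC_dirC (dy R b) sf.
rewrite {1}/dzbar (der_scale dD); last first.
  by apply: smoothCD => //; apply: smoothCM => //; exact: smoothC_cst.
rewrite (derD dD)//; last by apply: smoothCM => //; exact: smoothC_cst.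
by rewrite (der_scale dD 'i sy) (dz_dirC a (dx R b)) (dz_dirC a (dy R b)).
Qed.

End Commute.
End WirtingerChain.

(** * Changes of coordinates *)

Lemma smooth_id (R : realType) (V : normedModType R) (U : set V) : smooth_on U id.
Proof.
case=> [|k] /=; first by move=> x _; exact: cvg_id.
split=> [x _|v]; first exact: ex_diff.
rewrite (_ : (fun x => _) = cst v); first exact: Ck_cst.
by apply/funext => x; rewrite derive_id.
Qed.

Section LocalChange.
Variables (R : realType) (n : nat).
Variables (U V : set (Cn R n)) (w z : Cn R n -> Cn R n).
Variable phi : Cn R n -> 'M[Cplx R]_n.

(* The entry phi^a_b is [phi p a b]. *)
Definition twisted_dbar (b : 'I_n) (f : Cn R n -> Cplx R) (p : Cn R n) : Cplx R :=
  dzbar b f p - \sum_a phi p a b * dz a f p.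

Definition dz_mx (h : Cn R n -> Cn R n) (p : Cn R n) : 'M[Cplx R]_n :=
  \matrix_(k, a) dz a (coord k \o h) p.
Definition dzbar_mx (h : Cn R n -> Cn R n) (p : Cn R n) : 'M[Cplx R]_n :=
  \matrix_(k, a) dzbar a (coord k \o h) p.

Definition phi_dz (b : 'I_n) (p : Cn R n) : 'M[Cplx R]_n :=
  \matrix_(c, a) dz a (fun x => phi x c b) p.

(** [U] and [V] stand for the images of one overlap under two charts, with coordinate changes [w]
    and [z]. The Beltrami equation is written without an inverse, and it reduces to holomorphy of
    [w] when [phi] is zero. *)
Record local_change : Prop := LocalChange {
  lc_openU : open U;
  lc_openV : open V;
  lc_wV : forall p, U p -> V (w p);
  lc_zU : forall q, V q -> U (z q);
  lc_wK : forall p, U p -> z (w p) = p;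
  lc_zK : forall q, V q -> w (z q) = q;
  lc_w : smooth_on U w;
  lc_z : smooth_on V z;
  lc_phi : forall a b, smoothC_on U (fun p => phi p a b);
  lc_unit : forall p, U p -> dz_mx w p \in unitmx;
  lc_beltrami : forall p, U p -> dz_mx w p *m phi p = dzbar_mx w p }.

Hypothesis lc : local_change.
Let oU := lc_openU lc.
Let oV := lc_openV lc.

Lemma derivation_twisted b p : U p -> derivation U p (fun f => twisted_dbar b f p).
Proof.
move=> Up.
have := derivation_comb 1 (-1) (derivation_dzbar b oU Up)
  (derivation_sum (index_enum 'I_n) predT (fun a => phi p a b)
    (fun a => derivation_dz a oU Up)).
by congr derivation; apply/funext => f; rewrite mul1r mulN1r.
Qed.

Let coordw k : smoothC_on U (coord k \o w).
Proof. exact: smoothC_coord oU (lc_w lc). Qed.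

Let coordwz k q a : V q ->
  dz a (fun x => (coord k \o w) (z x)) q = (k == a)%:R /\
  dzbar a (fun x => (coord k \o w) (z x)) q = 0.
Proof.
move=> Vq; rewrite -(dz_coord a k q) -(dzbar_coord a k q).
split; [apply: (der_eq (derivation_dz a oV Vq))|apply: (der_eq (derivation_dzbar a oV Vq))];
  by move=> x Vx /=; rewrite (lc_zK lc Vx).
Qed.

Lemma dz_mx_comp q : V q ->
  dz_mx w (z q) *m dz_mx z q + dzbar_mx w (z q) *m map_mx Num.conj (dzbar_mx z q) = 1%:M.
Proof.
move=> Vq; apply/matrixP => k a; rewrite !mxE -(coordwz k a Vq).1.
rewrite (dz_comp _ Vq (lc_zU lc Vq) (lc_z lc) (coordw k)) big_split /=.
by congr (_ + _); apply: eq_bigr => b _; rewrite !mxE mulrC.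
Qed.

Lemma dzbar_mx_comp q : V q ->
  dz_mx w (z q) *m dzbar_mx z q + dzbar_mx w (z q) *m map_mx Num.conj (dz_mx z q) = 0.
Proof.
move=> Vq; apply/matrixP => k a; rewrite [RHS]mxE; apply: etrans (coordwz k a Vq).2.
rewrite !mxE.
rewrite (dzbar_comp _ Vq (lc_zU lc Vq) (lc_z lc) (coordw k)) big_split /=.
by congr (_ + _); apply: eq_bigr => b _; rewrite !mxE mulrC.
Qed.

Lemma dzbar_mx_inv q : V q ->
  dzbar_mx z q = - (phi (z q) *m map_mx Num.conj (dz_mx z q)).
Proof.
move=> Vq; have uJ := lc_unit lc (lc_zU lc Vq).
have := dzbar_mx_comp Vq; rewrite -(lc_beltrami lc (lc_zU lc Vq)) -mulmxA -mulmxDr.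
move/(congr1 (mulmx (invmx (dz_mx w (z q))))).
by rewrite mulKmx// mulmx0 => /eqP; rewrite addr_eq0 => /eqP.
Qed.

(** Cancel J in the chain rule for w o z = id, after replacing dw/dzbar by J phi. The right-hand
    side is visibly smooth, which is how [smoothC_invmx_dz_mx] gets the smoothness of the
    inverse. *)
Lemma invmx_dz_mx q : V q ->
  invmx (dz_mx w (z q)) = dz_mx z q + phi (z q) *m map_mx Num.conj (dzbar_mx z q).
Proof.
move=> Vq; have uJ := lc_unit lc (lc_zU lc Vq).
have := dz_mx_comp Vq; rewrite -(lc_beltrami lc (lc_zU lc Vq)) -mulmxA -mulmxDr.
by move/(congr1 (mulmx (invmx (dz_mx w (z q))))); rewrite mulKmx// mulmx1.
Qed.

(** In the chain rule the coefficients dz/dwbar of the holomorphic derivatives equal - phi N by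
    [dzbar_mx_inv], so they combine with N into [twisted_dbar]. *)
Lemma dzbar_pullback g c q : V q -> smoothC_on U g ->
  dzbar c (fun x => g (z x)) q =
  \sum_b (dz_mx z q b c)^* * twisted_dbar b g (z q).
Proof.
move=> Vq sg; rewrite (dzbar_comp _ Vq (lc_zU lc Vq) (lc_z lc) sg) big_split /=.
under [RHS]eq_bigr do rewrite /twisted_dbar mulrBr mulr_sumr.
rewrite sumrB addrC; congr (_ + _); first by apply: eq_bigr => b _; rewrite !mxE.
rewrite exchange_big -sumrN; apply: eq_bigr => a _ /=.
have -> : dzbar c (coord a \o z) q = dzbar_mx z q a c by rewrite mxE.
rewrite (dzbar_mx_inv Vq) !mxE mulNr mulr_suml; congr (- _).
by apply: eq_bigr => b _; rewrite !mxE -mulrA mulrCA.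
Qed.

(** This is [dzbar_pullback] for the conjugate of w^k, whose derivatives by wbar^c are Kronecker
    deltas. It shows N invertible and names its inverse. *)
Lemma conj_dz_mx_inv q : V q ->
  (map_mx Num.conj (dz_mx w (z q)) - map_mx Num.conj (dzbar_mx w (z q)) *m phi (z q))
    *m map_mx Num.conj (dz_mx z q) = 1%:M.
Proof.
move=> Vq; apply/matrixP => k c.
have sk : smoothC_on U (fun x => (coord k (w x))^*) by exact: (smoothC_conj oU (coordw k)).
have := dzbar_pullback c Vq sk.
have -> : dzbar c (fun x => (coord k (w (z x)))^*) q = (k == c)%:R.
  have sV : smoothC_on V (@coord R n k) by apply: (smoothC_coord k oV); exact: smooth_id.
  apply: (@etrans _ _ (dzbar c (fun x => (@coord R n k x)^*) q)).
    by apply: (der_eq (derivation_dzbar c oV Vq)) => x Vx /=; rewrite (lc_zK lc Vx).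
  by rewrite (dzbar_conj c Vq sV) dz_coord rmorph_nat.
move=> E; rewrite [RHS]mxE E mxE; apply: eq_bigr => b _.
rewrite !mxE mulrC /twisted_dbar; congr (_ * _).
rewrite (dzbar_conj b (lc_zU lc Vq) (coordw k)); congr (_ - _).
apply: eq_bigr => a _; rewrite !mxE mulrC; congr (_ * _).
by rewrite (dz_conj a (lc_zU lc Vq) (coordw k)).
Qed.

Lemma twisted_coord b k p : U p -> twisted_dbar b (coord k \o w) p = 0.
Proof.
move=> Up; have /matrixP/(_ k b) := lc_beltrami lc Up; rewrite !mxE => E.
apply/eqP; rewrite /twisted_dbar subr_eq0; apply/eqP; rewrite -E.
by apply: eq_bigr => a _; rewrite mxE mulrC.
Qed.

Lemma twisted_dz_mx b k a p : U p ->
  twisted_dbar b (fun x => dz_mx w x k a) p = (dz_mx w p *m phi_dz b p) k a.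
Proof.
move=> Up; have dD := derivation_dz a oU Up.
have -> : (fun x => dz_mx w x k a) = dz a (coord k \o w).
  by apply/funext => x; rewrite mxE.
have : dz a (twisted_dbar b (coord k \o w)) p = 0.
  by apply: etrans (der_cst dD 0); apply: (der_eq dD) => x /(twisted_coord b k).
rewrite /twisted_dbar.
have sw c : smoothC_on U (dz c (coord k \o w)) by exact: smoothC_dz.
have sphi c := lc_phi lc c b.
rewrite (derB oU dD); [|exact: smoothC_dzbar|]; last first.
  by apply: smoothC_sum => // c _; exact: smoothCM.
rewrite (dz_dzbar_comm oU Up (coordw k)) (der_sum oU dD); last first.
  by move=> c _; exact: smoothCM.
move/eqP; rewrite subr_eq0 => /eqP ->.
rewrite mxE -sumrB; apply: eq_bigr => c _.
(* By symmetry the second derivatives of w cancel, and the derivative of phi is what remains. *)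
rewrite (derM dD (sphi c) (sw c)) (dz_comm oU Up (coordw k)) addrK !mxE.
by rewrite mulrC.
Qed.

End LocalChange.

(** * Multi-indices and alternating functions *)

Section MultiIndex.
Variable T : finType.
Local Notation mi q := {ffun 'I_q -> T}.

Definition remove_at q (k : 'I_q.+1) (B : mi q.+1) : mi q := [ffun j => B (lift k j)].

Definition insert_at q (k : 'I_q.+1) (a : T) (C : mi q) : mi q.+1 :=
  [ffun i => if unlift k i is Some j then C j else a].

Lemma insert_at_id q (k : 'I_q.+1) a (C : mi q) : insert_at k a C k = a.
Proof. by rewrite ffunE unlift_none. Qed.

Lemma insert_at_lift q (k : 'I_q.+1) a (C : mi q) j : insert_at k a C (lift k j) = C j.
Proof. by rewrite ffunE liftK. Qed.

Lemma insert_atK q (k : 'I_q.+1) a (C : mi q) : remove_at k (insert_at k a C) = C.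
Proof. by apply/ffunP => j; rewrite ffunE insert_at_lift. Qed.

Lemma remove_atK q (k : 'I_q.+1) (B : mi q.+1) : insert_at k (B k) (remove_at k B) = B.
Proof.
apply/ffunP => i; rewrite ffunE; case: unliftP => [j ->|->//].
by rewrite ffunE.
Qed.

Lemma big_insert_at (V : nmodType) q (k : 'I_q.+1) (F : mi q.+1 -> V) :
  \sum_B F B = \sum_a \sum_C F (insert_at k a C).
Proof.
rewrite pair_bigA (reindex (fun p => insert_at k p.1 p.2)) //=.
exists (fun B : mi q.+1 => (B k, remove_at k B)) => [[a C] _|B _] /=.
  by rewrite insert_at_id insert_atK.
by rewrite remove_atK.
Qed.

Lemma remove_at2 q (k : 'I_q.+2) l (k' : 'I_q.+2) l' (B : mi q.+2) :
  lift k l = k' -> lift k' l' = k ->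
  remove_at l (remove_at k B) = remove_at l' (remove_at k' B).
Proof.
move=> E E'; apply/ffunP => j; rewrite !ffunE; congr (B _); apply/val_inj.
move/(congr1 val): E; move/(congr1 val): E'; rewrite /= /bump; lia.
Qed.

Variable K : numFieldType.

Lemma alternatingE q (c : mi q -> K) : alternating c <->
  forall (s : 'S_q) (I : mi q), c [ffun k => I (s k)] = (-1) ^+ odd_perm s * c I.
Proof.
split=> H s I; rewrite H; case: (odd_perm s);
  by rewrite ?expr0 ?expr1 ?mul1r ?mulN1r.
Qed.

(** Moving the inserted entry from slot [k] to the front is a cycle of length k + 1, that is
    [lift_perm k ord0 1], of sign (-1)^k. *)
Lemma alternating_insert_at q (c : mi q.+1 -> K) k a C : alternating c ->
  c (insert_at k a C) = (-1) ^+ k * c (insert_at ord0 a C).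
Proof.
move/alternatingE/(_ (lift_perm k ord0 1%g) (insert_at ord0 a C)).
rewrite odd_lift_perm odd_perm1 addbF /= addbF signr_odd => <-; congr c.
apply/ffunP => i; rewrite [RHS]ffunE; case: (unliftP k i) => [j ->|->].
  by rewrite lift_perm_lift perm1 !insert_at_lift.
by rewrite lift_perm_id !insert_at_id.
Qed.

(* With [k' = lift k l], the pairs (k, l) and (k', l') remove the same two
   indices; this involution reverses the sign. *)
Lemma sum_lift_sym q (G : 'I_q.+2 -> 'I_q.+1 -> K) :
  (forall k l k' l', lift k l = k' -> lift k' l' = k -> G k l = G k' l') ->
  \sum_(k < q.+2) \sum_(l < q.+1) (-1) ^+ (k + l) * G k l = 0.
Proof.
move=> symG; rewrite pair_bigA /=.
pose h (p : 'I_q.+2 * 'I_q.+1) : 'I_q.+2 * 'I_q.+1 :=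
  (lift p.1 p.2, inord (if (p.2 < p.1)%N then p.1.-1 else p.1)).
have h2 p : val (h p).2 = if (p.2 < p.1)%N then p.1.-1 else p.1.
  by rewrite /h /= inordK//; case: p => [[k Hk] [l Hl]] /=; case: ifP; lia.
have hE p : lift (h p).1 (h p).2 = p.1.
  apply/val_inj; move: (h2 p); rewrite /= => ->.
  by case: p => [[k Hk] [l Hl]] /=; rewrite /bump; case: ifP; lia.
have hK : involutive h.
  move=> p; case: p (hE p) (h2 p) => k l /= H1 H2.
  congr (_, _); first exact: H1.
  apply/val_inj; rewrite (h2 (h (k, l))) H2 /= /bump.
  by case: k l {H1 H2} => [k Hk] [l Hl] /=; do 2!case: ifP; lia.
have : \sum_(p : 'I_q.+2 * 'I_q.+1) (-1) ^+ (p.1 + p.2) * G p.1 p.2 =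
      - \sum_(p : 'I_q.+2 * 'I_q.+1) (-1) ^+ (p.1 + p.2) * G p.1 p.2.
  rewrite {1}(reindex_inj (inv_inj hK)) -sumrN; apply: eq_bigr => p _.
  rewrite -(symG p.1 p.2 (h p).1 (h p).2) ?hE// -mulNr; congr (_ * _).
  rewrite h2 -signr_odd -[in RHS]signr_odd -signrN.
  congr (_ ^+ nat_of_bool _); case: p => [[k Hk] [l Hl]] /=; rewrite /bump.
  by case: ifP; lia.
by move/eqP; rewrite -subr_eq0 opprK -mulr2n mulrn_eq0 /= => /eqP.
Qed.

Lemma perm_split q (s : 'S_q.+1) k : exists s' : 'S_q, s = lift_perm k (s k) s'.
Proof.
have ex j : {i | s (lift k j) = lift (s k) i}.
  case: (unliftP (s k) (s (lift k j))) => [i ->|/perm_inj E]; first by exists i.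
  by have := neq_lift k j; rewrite E eqxx.
have fI : injective (fun j => sval (ex j)).
  move=> i j /(congr1 (lift (s k))); rewrite -!(svalP (ex _)).
  by move/perm_inj/lift_inj.
exists (perm fI); apply/permP => i; case: (unliftP k i) => [j ->|->].
  by rewrite lift_perm_lift permE; exact: svalP (ex j).
by rewrite lift_perm_id.
Qed.

(** Reindex the sum by [s]. The permutation that [s] induces between the complements of [k] and of
    [s k] has the sign of [s] times (-1)^(k + s k), which absorbs the change of the alternating
    sign. *)
Lemma alternating_dsum q (u : T -> mi q -> K) : (forall a, alternating (u a)) ->
  alternating (fun B : mi q.+1 => \sum_(k < q.+1) (-1) ^+ k * u (B k) (remove_at k B)).
Proof.
move=> altu; apply/alternatingE => s B.
rewrite [in RHS](reindex_inj (@perm_inj _ s)) mulr_sumr; apply: eq_bigr => k _.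
have [s' Es] := perm_split s k; rewrite ffunE.
have -> : remove_at k [ffun k => B (s k)] = [ffun j => remove_at (s k) B (s' j)].
  by apply/ffunP => j; rewrite !ffunE Es lift_perm_lift -Es.
rewrite ((alternatingE _).1 (altu _)) !mulrA; congr (_ * _).
rewrite [in RHS]Es odd_lift_perm -Es -[in LHS](signr_odd _ k) -[in RHS](signr_odd _ (s k)).
rewrite -!signr_addb; congr (_ ^+ nat_of_bool _).
by case: (odd k) (odd (s k)) (odd_perm s') => [] [] [].
Qed.

End MultiIndex.

(** * Tensor representations *)

Lemma perm_ffun_inj (I T : finType) (s : {perm I}) :
  injective (fun f : {ffun I -> T} => [ffun k => f (s k)]).
Proof.
move=> f f' /ffunP H; apply/ffunP => k.
by have := H ((s^-1)%g k); rewrite !ffunE permKV.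
Qed.

Section TensorAlgebra.
Variables (R : realType) (n : nat).
Local Notation C := (Cplx R).
Implicit Types (E : tensor_bundle) (g h : 'M[C]_n).

Lemma prod_eq_ffun (I T : finType) (f f' : {ffun I -> T}) :
  \prod_i (f i == f' i)%:R = (f == f')%:R :> C.
Proof.
case: eqP => [->|ff']; first by rewrite big1// => i _; rewrite eqxx.
have [i fi] : exists i, f i != f' i.
  apply/existsP; apply: contra_notT ff'; rewrite negb_exists => /forallP H.
  by apply/ffunP => i; have /negbNE/eqP := H i.
by rewrite (bigD1 i)//= (negbTE fi) mul0r.
Qed.

Lemma tensor_mx1 E (e e' : tidx n E) : tensor_mx (1%:M : 'M[C]_n) e e' = (e == e')%:R.
Proof.
elim: E e e' => [||E1 IH1 E2 IH2|p E IH] /= e e'.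
- by rewrite mxE.
- by rewrite invmx1 mxE eq_sym.
- by rewrite IH1 IH2 -natrM mulnb -pair_eqE.
- by under eq_bigr do rewrite IH; exact: prod_eq_ffun.
Qed.

Lemma invmx_mul g h : g \in unitmx -> h \in unitmx ->
  invmx (g *m h) = invmx h *m invmx g.
Proof.
move=> ug uh; have ugh : g *m h \in unitmx by rewrite unitmx_mul ug.
apply: (can_inj (mulKmx ugh)); rewrite mulmxV// -mulmxA (mulmxA h) mulmxV//.
by rewrite mul1mx mulmxV.
Qed.

(** Invertibility enters through [Cotangent], where the representation is by inverse transposes. In
    the exterior case a product of sums is distributed over all multi-indices. *)
Lemma tensor_mxM E g h (e e'' : tidx n E) : g \in unitmx -> h \in unitmx ->
  tensor_mx (g *m h) e e'' = \sum_e' tensor_mx g e e' * tensor_mx h e' e''.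
Proof.
move=> ug uh; elim: E e e'' => [||E1 IH1 E2 IH2|p E IH] /= e e''.
- by rewrite mxE.
- by rewrite invmx_mul// mxE; apply: eq_bigr => i _; rewrite mulrC.
- rewrite IH1 IH2 mulr_suml.
  rewrite -(pair_bigA _ (fun e1 e2 => tensor_mx g e.1 e1 * tensor_mx g e.2 e2 *
     (tensor_mx h e1 e''.1 * tensor_mx h e2 e''.2))) /=.
  apply: eq_bigr => e1 _; rewrite mulr_sumr; apply: eq_bigr => e2 _.
  by rewrite mulrACA.
- under eq_bigr do rewrite IH.
  by rewrite bigA_distr_bigA; apply: eq_bigr => f _; rewrite big_split.
Qed.

Section Act.
Variables (E : tensor_bundle) (q : nat).
Implicit Types (P Q : 'M[C]_n) (c : {ffun 'I_q -> 'I_n} -> tidx n E -> C).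

(** The pointwise transformation law of E-valued (0,q)-forms. The form indices are multiplied by [P]
    from the right and the bundle index by [Q] from the left, hence the opposite orders of
    composition in [actM]. *)
Definition act P Q c : {ffun 'I_q -> 'I_n} -> tidx n E -> C := fun B e =>
  \sum_(B' : {ffun 'I_q -> 'I_n}) \sum_e' (\prod_k P (B' k) (B k)) * tensor_mx Q e e' * c B' e'.

Lemma act1 c B e : act 1%:M 1%:M c B e = c B e.
Proof.
rewrite /act (bigD1 B)//= [X in _ + X]big1 ?addr0; last first.
  move=> B' B'B; apply: big1 => e' _.
  under eq_bigr do rewrite mxE.
  by rewrite prod_eq_ffun (negbTE B'B) !mul0r.
rewrite (bigD1 e)//= [X in _ + X]big1 ?addr0; last first.
  by move=> e' e'e; rewrite tensor_mx1 eq_sym (negbTE e'e) mulr0 mul0r.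
under eq_bigr do rewrite mxE.
by rewrite prod_eq_ffun tensor_mx1 !eqxx !mul1r.
Qed.

Lemma actM P P' Q Q' c B e : Q \in unitmx -> Q' \in unitmx ->
  act P' Q' (act P Q c) B e = act (P *m P') (Q' *m Q) c B e.
Proof.
move=> uQ uQ'; rewrite /act.
transitivity (\sum_(B' : {ffun 'I_q -> 'I_n}) \sum_(B'' : {ffun 'I_q -> 'I_n}) \sum_e' \sum_e''
   (\prod_k P' (B' k) (B k)) * tensor_mx Q' e e' *
   ((\prod_k P (B'' k) (B' k)) * tensor_mx Q e' e'' * c B'' e'')).
  apply: eq_bigr => B' _; rewrite exchange_big; apply: eq_bigr => e' _ /=.
  by rewrite mulr_sumr; apply: eq_bigr => B'' _; rewrite mulr_sumr.
rewrite exchange_big; apply: eq_bigr => B'' _ /=.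
transitivity (\sum_e'' (\sum_(B' : {ffun 'I_q -> 'I_n})
      (\prod_k P' (B' k) (B k)) * \prod_k P (B'' k) (B' k)) *
    (\sum_e' tensor_mx Q' e e' * tensor_mx Q e' e'') * c B'' e'').
  under eq_bigr do rewrite exchange_big /=.
  rewrite exchange_big /=; apply: eq_bigr => e'' _.
  rewrite !mulr_suml; apply: eq_bigr => B' _.
  rewrite mulr_sumr mulr_suml; apply: eq_bigr => e' _.
  by rewrite !mulrA; congr (_ * _ * _); rewrite mulrAC.
apply: eq_bigr => e'' _; rewrite tensor_mxM//; congr (_ * _ * _).
under [RHS]eq_bigr do rewrite mxE.
rewrite bigA_distr_bigA; apply: eq_bigr => B' _.
by rewrite -big_split; apply: eq_bigr => k _; rewrite mulrC.
Qed.

(** Permuting [B] and the summation index together leaves the product of entries of [P] unchanged,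
    so the sign of [c] passes through the sum. *)
Lemma act_alternating P Q c e : (forall e, alternating (c ^~ e)) ->
  alternating (fun B => act P Q c B e).
Proof.
move=> altc; apply/alternatingE => s B; rewrite /act mulr_sumr.
rewrite [LHS](reindex_inj (@perm_ffun_inj _ _ s)) /=.
apply: eq_bigr => B' _; rewrite mulr_sumr; apply: eq_bigr => e' _.
rewrite ((alternatingE _).1 (altc e')) mulrCA; congr (_ * (_ * _ * _)).
by rewrite [RHS](reindex_inj (@perm_inj _ s)); apply: eq_bigr => k _; rewrite !ffunE.
Qed.

End Act.

Lemma alternating_lin p (T : finType) (a : C) (c c' : {ffun 'I_p -> T} -> C) :
  alternating c -> alternating c' ->
  alternating (fun I => a * c I + c' I).
Proof.
move=> Hc Hc' s I; rewrite Hc Hc'; case: (odd_perm s) => //.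
by rewrite mulrN opprD.
Qed.

Lemma in_fiber_lin E (a : C) (c c' : tidx n E -> C) :
  in_fiber c -> in_fiber c' -> in_fiber (fun e => a * c e + c' e).
Proof.
elim: E c c' => [||E1 IH1 E2 IH2|p E IH] //= c c'.
  move=> [H1 H2] [H1' H2']; split=> e; first exact: IH1.
  exact: IH2.
move=> [H1 H2] [H1' H2']; split; first exact: alternating_lin.
by move=> I k; exact: IH.
Qed.

Lemma in_fiber0 E : in_fiber (fun=> 0 : C) (E := E) (n := n).
Proof.
elim: E => [||E1 IH1 E2 IH2|p E IH] //=; split => //.
by move=> s I; rewrite oppr0 if_same.
Qed.

Lemma in_fiber_sum E (I : Type) (r : seq I) (P : pred I) (a : I -> C)
    (c : I -> tidx n E -> C) :
  (forall i, P i -> in_fiber (c i)) ->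
  in_fiber (fun e => \sum_(i <- r | P i) a i * c i e).
Proof.
move=> Hc; elim: r => [|i r IH].
  by rewrite (_ : (fun e => _) = fun=> 0); [exact: in_fiber0|apply/funext => e; rewrite big_nil].
case: (boolP (P i)) => Pi.
  rewrite (_ : (fun e => _) = fun e => a i * c i e + \sum_(i <- r | P i) a i * c i e).
    by apply: in_fiber_lin => //; exact: Hc.
  by apply/funext => e; rewrite big_cons Pi.
rewrite (_ : (fun e => _) = fun e => \sum_(i <- r | P i) a i * c i e) //.
by apply/funext => e; rewrite big_cons (negbTE Pi).
Qed.

(* The equations defining the fiber are of the form [c e' = c e] and
   [c e' = - c e]. *)
Lemma in_fiber_odd E (Z : Type) (c : tidx n E -> Z -> C) (L : (Z -> C) -> C) :
  (forall e, L (fun z => - c e z) = - L (c e)) ->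
  (forall z, in_fiber (fun e => c e z)) -> in_fiber (fun e => L (c e)).
Proof.
elim: E c => [||E1 IH1 E2 IH2|p E IH] //= c LN H.
  split=> [e2|e1]; first by apply: (IH1 (fun e1 => c (e1, e2))) => // z; case: (H z).
  by apply: (IH2 (fun e2 => c (e1, e2))) => // z; case: (H z).
split=> [s I|I k]; last first.
  by apply: (IH (fun e => c [ffun l => if l == k then e else I l])) => // z; case: (H z).
case: (boolP (odd_perm s)) => os.
  rewrite -LN; congr L; apply/funext => z.
  by have [-> _] := H z; rewrite os.
by congr L; apply/funext => z; have [-> _] := H z; rewrite (negbTE os).
Qed.

(** Fix all indices but one: the sum becomes the matrix of one factor applied to a linear
    combination of slices of [c], and these lie in the fiber of that factor. For exterior powers
    alternation is a separate reindexing. *)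
Lemma in_fiber_tensor_mx E g (c : tidx n E -> C) :
  in_fiber c -> in_fiber (fun e => \sum_e' tensor_mx g e e' * c e').
Proof.
elim: E c => [||E1 IH1 E2 IH2|p E IH] //= c.
  move=> [H1 H2]; split=> [e2|e1].
    rewrite (_ : (fun e1 => _) = fun e1 => \sum_e1' tensor_mx g e1 e1' *
        \sum_e2' tensor_mx g e2 e2' * c (e1', e2')).
      by apply: IH1; apply: in_fiber_sum => e2' _; exact: H1.
    apply/funext => e1; under [RHS]eq_bigr do rewrite mulr_sumr.
    by rewrite pair_bigA; apply: eq_bigr => -[e1' e2'] _ /=; rewrite mulrA.
  rewrite (_ : (fun e2 => _) = fun e2 => \sum_e2' tensor_mx g e2 e2' *
      \sum_e1' tensor_mx g e1 e1' * c (e1', e2')).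
    by apply: IH2; apply: in_fiber_sum => e1' _; exact: H2.
  apply/funext => e2; under [RHS]eq_bigr do rewrite mulr_sumr.
  rewrite exchange_big pair_bigA; apply: eq_bigr => -[e1' e2'] _ /=.
  by rewrite mulrCA mulrA.
move=> [H1 H2]; split.
  apply/alternatingE => s I; rewrite mulr_sumr.
  rewrite [LHS](reindex_inj (@perm_ffun_inj _ _ s)) /=.
  apply: eq_bigr => I' _; rewrite ((alternatingE _).1 H1) mulrCA; congr (_ * (_ * _)).
  by rewrite [RHS](reindex_inj (@perm_inj _ s)); apply: eq_bigr => k _; rewrite !ffunE.
case: p c H1 H2 => [|p] c H1 H2 I k; first by case: k.
(* Summation multi-indices are split into their value at slot [k] and the rest [J]; only the former
   meets the variable index [e]. *)
rewrite (_ : (fun e => _) = fun e => \sum_e' tensor_mx g e e' *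
    \sum_(J : {ffun 'I_p -> tidx n E})
      (\prod_l tensor_mx g (I (lift k l)) (J l)) * c (insert_at k e' J)).
  apply: IH; apply: in_fiber_sum => J _.
  have := H2 (insert_at k (I k) J) k; congr in_fiber; apply/funext => e; congr c.
  apply/ffunP => l; rewrite !ffunE; case: unliftP => [j ->|->].
    by rewrite eq_sym (negbTE (neq_lift k j)).
  by rewrite eqxx.
apply/funext => e; rewrite (big_insert_at k); apply: eq_bigr => e' _.
rewrite mulr_sumr; apply: eq_bigr => J _; rewrite (bigD1_ord k)//= mulrA.
rewrite insert_at_id ffunE eqxx; congr (_ * _ * _).
apply: eq_bigr => l _; rewrite insert_at_lift ffunE.
by rewrite eq_sym (negbTE (neq_lift k l)).
Qed.

Lemma act_fiber E q P Q (c : {ffun 'I_q -> 'I_n} -> tidx n E -> C) B :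
  (forall B, in_fiber (c B)) -> in_fiber (act P Q c B).
Proof.
move=> Hc; rewrite (_ : act P Q c B = fun e =>
    \sum_(B' : {ffun 'I_q -> 'I_n}) (\prod_k P (B' k) (B k)) *
    \sum_e' tensor_mx Q e e' * c B' e').
  by apply: in_fiber_sum => B' _; exact: in_fiber_tensor_mx.
apply/funext => e; apply: eq_bigr => B' _; rewrite mulr_sumr.
by apply: eq_bigr => e' _; rewrite mulrA.
Qed.

End TensorAlgebra.

(** * The connection form of the deformed operator *)

Section Connection.
Variables (R : realType) (n : nat).
Local Notation C := (Cplx R).

(* The derivative of [tensor_mx] at the identity matrix, in the direction P. *)
Fixpoint conn (E : tensor_bundle) (P : 'M[C]_n) : tidx n E -> tidx n E -> C :=
  match E with
  | Tangent => fun a b => P a b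
  | Cotangent => fun a b => - P b a
  | Tensor E1 E2 => fun a b =>
      conn P a.1 b.1 * (a.2 == b.2)%:R + (a.1 == b.1)%:R * conn P a.2 b.2
  | Exterior p E1 => fun a b =>
      \sum_(k < p) conn P (a k) (b k) * \prod_(l < p | l != k) (a l == b l)%:R
  end.

Lemma conn0 E (a b : tidx n E) : conn 0 a b = 0.
Proof.
elim: E a b => [||E1 IH1 E2 IH2|p E IH] /= a b; rewrite ?mxE ?oppr0//.
  by rewrite IH1 IH2 mul0r mulr0 addr0.
by apply: big1 => k _; rewrite IH mul0r.
Qed.

Lemma smoothC_tensor_mx (U : set (Cn R n)) (G : Cn R n -> 'M[C]_n) E (e e' : tidx n E) :
  open U -> (forall i j, smoothC_on U (fun x => G x i j)) ->
  (forall i j, smoothC_on U (fun x => invmx (G x) i j)) ->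
  smoothC_on U (fun x => tensor_mx (G x) e e').
Proof.
move=> oU sG sG'; elim: E e e' => [||E1 IH1 E2 IH2|p E IH] //= e e'.
  exact: smoothCM.
exact: smoothC_prod.
Qed.

(** If D G = G P, a representation rho satisfies D rho(G) = rho(G) drho(P); [conn] is this drho. The
    assumption on the inverse matrix is what D (G^-1 G) = 0 yields and feeds the cotangent case. *)
Lemma der_tensor_mx (U : set (Cn R n)) p D (G : Cn R n -> 'M[C]_n) P E (e e' : tidx n E) :
  open U -> derivation U p D ->
  (forall i j, smoothC_on U (fun x => G x i j)) ->
  (forall i j, smoothC_on U (fun x => invmx (G x) i j)) ->
  (forall i j, D (fun x => G x i j) = (G p *m P) i j) ->
  (forall i j, D (fun x => invmx (G x) i j) = - (P *m invmx (G p)) i j) ->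
  D (fun x => tensor_mx (G x) e e') = \sum_e'' tensor_mx (G p) e e'' * conn P e'' e'.
Proof.
move=> oU dD sG sG' DG DG'.
have st := fun E e e' => @smoothC_tensor_mx U G E e e' oU sG sG'.
elim: E e e' => [||E1 IH1 E2 IH2|m E IH] /= e e'.
- by rewrite DG mxE.
- by rewrite DG' mxE -sumrN; apply: eq_bigr => i _; rewrite mulrN mulrC.
- rewrite (derM dD)// IH1 IH2.
  under [RHS]eq_bigr do rewrite mulrDr.
  rewrite big_split /=; congr (_ + _).
    rewrite -(pair_bigA _ (fun e1 e2 => tensor_mx (G p) e.1 e1 * tensor_mx (G p) e.2 e2 *
       (conn P e1 e'.1 * (e2 == e'.2)%:R))) /= mulr_suml.
    apply: eq_bigr => e1 _; rewrite (bigD1 e'.2)//= [X in _ = _ + X]big1.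
      by rewrite eqxx mulr1 addr0 mulrAC.
    by move=> i /negbTE ->; rewrite !mulr0.
  rewrite -(pair_bigA _ (fun e1 e2 => tensor_mx (G p) e.1 e1 * tensor_mx (G p) e.2 e2 *
       ((e1 == e'.1)%:R * conn P e2 e'.2))) /= exchange_big /= mulr_sumr.
  apply: eq_bigr => e2 _; rewrite (bigD1 e'.1)//= [X in _ = _ + X]big1.
    by rewrite eqxx mul1r addr0 mulrA.
  by move=> i /negbTE ->; rewrite mul0r !mulr0.
- rewrite (der_prod oU dD); last by move=> i; exact: st.
  under [RHS]eq_bigr do rewrite mulr_sumr.
  rewrite exchange_big /=; apply: eq_bigr => k _; rewrite IH.
  (* Slot [k] carries the derivative and every other slot a Kronecker delta, which makes the term a
     product of sums that can be distributed. *)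
  pose H l x := tensor_mx (G p) (e l) x *
    (if l == k then conn P x (e' k) else (x == e' l)%:R).
  transitivity (\prod_l \sum_x H l x).
    rewrite [RHS](bigD1 k)//=; congr (_ * _).
      by apply: eq_bigr => x _; rewrite /H eqxx.
    apply: eq_bigr => l lk; rewrite (bigD1 (e' l))//= [X in _ = _ + X]big1.
      by rewrite /H (negbTE lk) eqxx mulr1 addr0.
    by move=> x /negbTE xl; rewrite /H (negbTE lk) xl mulr0.
  rewrite bigA_distr_bigA; apply: eq_bigr => f _.
  rewrite big_split /=; congr (_ * _).
  rewrite (bigD1 k)//= eqxx; congr (_ * _).
  by apply: eq_bigr => l /negbTE ->.
Qed.

Lemma dz_cst a (c : C) (p : Cn R n) : dz a (fun=> c) p = 0.
Proof. by rewrite (der_cst (derivation_dz a openT I)). Qed.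

Lemma dzbar_cst a (c : C) (p : Cn R n) : dzbar a (fun=> c) p = 0.
Proof. by rewrite (der_cst (derivation_dzbar a openT I)). Qed.

Variable phi : tform R n Tangent 1.

Definition phi_mx (p : Cn R n) : 'M[C]_n := \matrix_(a, b) phi [ffun=> b] a p.

Lemma phi_mxE c b : (fun x => phi_mx x c b) = phi [ffun=> b] c.
Proof. by apply/funext => x; rewrite mxE. Qed.

(** The frame has constant coefficients, so only terms that differentiate phi survive: the second
    half of the bracket on vectors, and - del i_phi on covectors. Their opposite signs are those of
    a representation and its dual. *)
Lemma ang_frameE E (e e' : tidx n E) b p :
  ang_frame phi e [ffun=> b] e' p = - conn (phi_dz phi_mx b p) e' e.
Proof.
elim: E e e' => [||E1 IH1 E2 IH2|m E IH] /= e e'.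
- rewrite /bracket mxE phi_mxE (bigD1 e)//= [X in _ + X]big1 ?addr0; last first.
    move=> c /negbTE ce; rewrite /wedgel /wedger !big_ord1 /dform0 /component /frame.
    by rewrite /= dz_cst ce mulr0 !mul0r !mulr0 subrr.
  rewrite /wedgel /wedger !big_ord1 /dform0 /phi_comp /component /frame /= dz_cst eqxx.
  by rewrite !mulr0 sub0r subnn !expr0 !mul1r ffunE.
- rewrite opprK mxE phi_mxE /cotangent_of_form /lie /del big_ord1 expr0 mul1r expr1 mulN1r.
  rewrite opprB /contr [X in _ - _ * X]big1 ?mulr0 ?subr0; last first.
    move=> c _; rewrite /wedgel big_ord1 /= big_ord_recl big_ord1 /form_of_cotangent /frame.
    by rewrite !dz_cst !(mulr0, addr0).
  rewrite ffunE; apply: (f_equal (fun f => dz e' f p)); apply/funext => x.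
  have fE c : wedgel (phi_comp phi c)
      (form_of_cotangent (@frame R n Cotangent e) (cons_idx c (omit ord0 [ffun=> e'])))
      [ffun=> b] x =
      phi [ffun=> b] c x * (c == e)%:R.
    rewrite /wedgel big_ord1 /form_of_cotangent /frame.
    rewrite [cons_idx _ _ _]ffunE unlift_none.
    by rewrite !expr0 !mul1r ffunE.
  rewrite expr0 mul1r; under eq_bigr do rewrite fE.
  rewrite (bigD1 e)//= [X in _ + X]big1 ?addr0; first by rewrite eqxx mulr1.
  by move=> c /negbTE ->; rewrite mulr0.
- by rewrite IH1 IH2 mulNr mulrN opprD.
- by rewrite -sumrN; apply: eq_bigr => k _; rewrite IH mulNr.
Qed.

(** The covariant derivative along D_b; by [delbar_ang] the deformed operator is its
    antisymmetrization. *)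
Definition cov (E : tensor_bundle) b (s : tidx n E -> Cn R n -> C) (e : tidx n E) p : C :=
  twisted_dbar phi_mx b (s e) p + \sum_e' conn (phi_dz phi_mx b p) e e' * s e' p.

Lemma delbar_ang E q (s : tform R n E q) B e p :
  delbar s B e p - ang phi s B e p =
  \sum_(k < q.+1) (-1) ^+ k * cov (B k) (s (omit k B)) e p.
Proof.
rewrite /delbar /ang opprD addrA.
have -> : lie0 phi (component s e) B p =
    \sum_(k < q.+1) (-1) ^+ k * \sum_a phi_mx p a (B k) * dz a (s (omit k B) e) p.
  rewrite /lie0 /lie /contr expr0 mul1r /wedgel exchange_big; apply: eq_bigr => k _ /=.
  rewrite mulr_sumr; apply: eq_bigr => a _; congr (_ * (_ * _)).
    by rewrite mxE.
  by rewrite /del big_ord1 expr0 mul1r ffunE unlift_none.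
rewrite -sumrB mulr_sumr -sumrN.
under [X in _ + X]eq_bigr do rewrite /wedger mulr_sumr -sumrN.
rewrite exchange_big -big_split; apply: eq_bigr => k _ /=.
rewrite /cov mulrDr /twisted_dbar mulrBr; congr (_ + _).
rewrite mulr_sumr; apply: eq_bigr => e' _.
rewrite {2}/component ang_frameE !mulrN opprK.
(* The sign (-1)^q of Leibniz's rule and the sign (-1)^(q - k) of wedging on the right combine to
   the sign (-1)^k of the Dolbeault operator. *)
have -> : (-1) ^+ k = (-1) ^+ q * (-1) ^+ (q - k) :> C.
  rewrite -exprD -signr_odd -[RHS]signr_odd oddD oddB ?leq_ord//.
  by rewrite addbA addbb.
by rewrite -!mulrA; congr (_ * (_ * _)); rewrite mulrC.
Qed.

End Connection.

(** * The Dolbeault operator under a change of coordinates *)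

Section Pullback.
Variables (R : realType) (n : nat).
Local Notation C := (Cplx R).
Variables (U V : set (Cn R n)) (w z : Cn R n -> Cn R n) (phi : Cn R n -> 'M[C]_n).
Hypothesis lc : local_change U V w z phi.
Let oU := lc_openU lc.
Let oV := lc_openV lc.
Local Notation N := (fun x => map_mx Num.conj (dz_mx z x)).

Lemma conj_dz_mxE (x : Cn R n) b c : N x b c = (dz c (coord b \o z) x)^*.
Proof. by rewrite !mxE. Qed.

Lemma smoothC_conj_dz_mx b c : smoothC_on V (fun x => N x b c).
Proof.
have := smoothC_conj oV (smoothC_dz c oV (smoothC_coord b oV (lc_z lc))).
by apply: smoothC_eq => // x _; rewrite conj_dz_mxE.
Qed.

Lemma dzbar_conj_dz_mx b c d x : V x ->
  dzbar d (fun x => N x b c) x = dzbar c (fun x => N x b d) x.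
Proof.
move=> Vx; have sz := smoothC_coord b oV (lc_z lc).
have E c' d' : dzbar d' (fun x => N x b c') x = (dz d' (dz c' (coord b \o z)) x)^*.
  rewrite -(dzbar_conj d' Vx (smoothC_dz c' oV sz)).
  apply: (f_equal (fun f => dzbar d' f x)); apply/funext => y; exact: conj_dz_mxE.
by rewrite !E (dz_comm oV Vx sz).
Qed.

(* The terms in which N is differentiated cancel, as N is the conjugate of a
   Jacobian matrix and F is alternating. *)
Lemma dolbeault_pullback q (F : {ffun 'I_q -> 'I_n} -> Cn R n -> C) x
    (B : {ffun 'I_q.+1 -> 'I_n}) :
  V x -> (forall B', smoothC_on U (F B')) ->
  alternating (fun B' => F B' (z x)) ->
  \sum_(k < q.+1) (-1) ^+ k *
     dzbar (B k) (fun y => \sum_(B' : {ffun 'I_q -> 'I_n})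
       (\prod_l N y (B' l) (remove_at k B l)) * F B' (z y)) x =
  \sum_(B' : {ffun 'I_q.+1 -> 'I_n}) (\prod_k N x (B' k) (B k)) *
     \sum_(k < q.+1) (-1) ^+ k * twisted_dbar phi (B' k) (F (remove_at k B')) (z x).
Proof.
move=> Vx sF altF.
have sN := smoothC_conj_dz_mx.
have sFz B' : smoothC_on V (fun y => F B' (z y)).
  exact: smoothC_comp oV (lc_zU lc) (lc_z lc) (sF B').
have sP (B1 B2 : {ffun 'I_q -> 'I_n}) : smoothC_on V (fun y => \prod_l N y (B1 l) (B2 l)).
  by apply: smoothC_prod.
have split_k (k : 'I_q.+1) :
  dzbar (B k) (fun y => \sum_(B' : {ffun 'I_q -> 'I_n})
       (\prod_l N y (B' l) (remove_at k B l)) * F B' (z y)) x =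
  \sum_(B' : {ffun 'I_q -> 'I_n}) (\sum_l dzbar (B k) (fun y => N y (B' l) (remove_at k B l)) x *
             \prod_(j | j != l) N x (B' j) (remove_at k B j)) * F B' (z x) +
  \sum_(B' : {ffun 'I_q -> 'I_n}) (\prod_l N x (B' l) (remove_at k B l)) *
     \sum_b N x b (B k) * twisted_dbar phi b (F B') (z x).
  have dD := derivation_dzbar (B k) oV Vx.
  rewrite (der_sum oV dD); last by move=> B' _; exact: smoothCM.
  rewrite -big_split; apply: eq_bigr => B' _ /=.
  rewrite (derM dD)// (der_prod oV dD)//; congr (_ + _ * _).
  by rewrite (dzbar_pullback lc)//; apply: eq_bigr => b _; rewrite [in RHS]mxE.
under eq_bigr do rewrite split_k mulrDr.
rewrite big_split /= [X in X + _](_ : _ = 0) ?add0r; last first.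
  case: q F B sF altF sFz sP split_k => [|q] F B sF altF sFz sP split_k.
    by apply: big1 => k _; rewrite big1 ?mulr0// => B' _; rewrite big_ord0 mul0r.
  (* Moving the index of the differentiated entry to the front of F costs (-1)^l. What is left
     depends only on the unordered pair of removed slots, as [sum_lift_sym] requires. *)
  pose G (k : 'I_q.+2) (l : 'I_q.+1) : C := \sum_b \sum_(D : {ffun 'I_q -> 'I_n})
    dzbar (B k) (fun y => N y b (B (lift k l))) x *
    (\prod_j N x (D j) (remove_at l (remove_at k B) j)) * F (insert_at ord0 b D) (z x).
  rewrite -[RHS](@sum_lift_sym C q G); last first.
    move=> k l k' l' E E'; apply: eq_bigr => b _; apply: eq_bigr => D _.
    by rewrite (remove_at2 B E E') E E' (dzbar_conj_dz_mx _ _ _ Vx).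
  apply: eq_bigr => k _; under eq_bigr do rewrite mulr_suml.
  rewrite exchange_big mulr_sumr; apply: eq_bigr => l _ /=.
  rewrite exprD -mulrA; congr (_ * _).
  rewrite (big_insert_at l) mulr_sumr; apply: eq_bigr => b _.
  rewrite mulr_sumr; apply: eq_bigr => D _.
  rewrite (alternating_insert_at l b D altF) insert_at_id [remove_at k B l]ffunE.
  rewrite mulrCA; congr (_ * (_ * _ * _)).
  rewrite big_mkcond (bigD1_ord l)//= eqxx mul1r; apply: eq_bigr => j _.
  by rewrite eq_sym neq_lift insert_at_lift !ffunE.
under [RHS]eq_bigr do rewrite mulr_sumr.
rewrite exchange_big; apply: eq_bigr => k _ /=.
rewrite (big_insert_at k) mulr_sumr exchange_big /=.
under [RHS]eq_bigr do under eq_bigr do rewrite insert_at_id insert_atK.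
apply: eq_bigr => D _; rewrite !mulr_sumr; apply: eq_bigr => b _.
rewrite (bigD1_ord k)//= insert_at_id [RHS]mulrCA; congr (_ * _).
rewrite mulrA [X in X * _]mulrC; congr (_ * _ * _).
by apply: eq_bigr => l _; rewrite insert_at_lift ffunE.
Qed.

End Pullback.

Lemma smoothC_act (R : realType) (n : nat) (U : set (Cn R n)) E q
    (P Q : Cn R n -> 'M[Cplx R]_n) (s : tform R n E q) B e :
  open U -> (forall i j, smoothC_on U (fun x => P x i j)) ->
  (forall i j, smoothC_on U (fun x => Q x i j)) ->
  (forall i j, smoothC_on U (fun x => invmx (Q x) i j)) ->
  (forall B' e', smoothC_on U (s B' e')) ->
  smoothC_on U (fun x => act (P x) (Q x) (fun B' e' => s B' e' x) B e).
Proof.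
move=> oU sP sQ sQ' ss; apply: smoothC_sum => // B' _; apply: smoothC_sum => // e' _.
apply: smoothCM => //; apply: smoothCM => //; first exact: smoothC_prod.
exact: smoothC_tensor_mx.
Qed.

Section TensorPullback.
Variables (R : realType) (n : nat).
Local Notation C := (Cplx R).
Variables (U V : set (Cn R n)) (w z : Cn R n -> Cn R n) (phi : tform R n Tangent 1).
Hypothesis lc : local_change U V w z (phi_mx phi).
Let oU := lc_openU lc.
Let oV := lc_openV lc.
Local Notation J := (dz_mx w).
Local Notation N := (fun x => map_mx Num.conj (dz_mx z x)).

Lemma smoothC_dz_mx i j : smoothC_on U (fun p => J p i j).
Proof.
have := smoothC_dz j oU (smoothC_coord i oU (lc_w lc)).
by apply: smoothC_eq => // x _; rewrite mxE.
Qed.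

Lemma smoothC_dzbar_mx i j : smoothC_on U (fun p => dzbar_mx w p i j).
Proof.
have := smoothC_dzbar j oU (smoothC_coord i oU (lc_w lc)).
by apply: smoothC_eq => // x _; rewrite mxE.
Qed.

Lemma smoothC_invmx_dz_mx i j : smoothC_on U (fun p => invmx (J p) i j).
Proof.
have sV c : smoothC_on V (coord c \o z) by exact: smoothC_coord oV (lc_z lc).
have sw f : smoothC_on V f -> smoothC_on U (fun p => f (w p)).
  by move=> sf; exact: smoothC_comp oU (lc_wV lc) (lc_w lc) sf.
have : smoothC_on U (fun p => dz j (coord i \o z) (w p) +
    \sum_a phi_mx phi p i a * (dzbar j (coord a \o z) (w p))^*).
  apply: smoothCD => //; first exact: (sw _ (smoothC_dz j oV (sV i))).
  apply: smoothC_sum => // a _; apply: smoothCM => //; first exact: (lc_phi lc).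
  exact: (smoothC_conj oU (sw _ (smoothC_dzbar j oV (sV a)))).
apply: smoothC_eq => // p Up.
have := invmx_dz_mx lc (lc_wV lc Up); rewrite (lc_wK lc Up) => ->.
rewrite mxE [X in _ = X + _]mxE [X in _ = _ + X]mxE.
by congr (_ + _); apply: eq_bigr => a _; rewrite !mxE.
Qed.

(** Apply D_b to J^-1 J = 1 and use D_b J = J P, where P is the matrix of derivatives of phi. *)
Lemma twisted_invmx_dz_mx b i j p : U p ->
  twisted_dbar (phi_mx phi) b (fun x => invmx (J x) i j) p =
  - (phi_dz (phi_mx phi) b p *m invmx (J p)) i j.
Proof.
move=> Up; have dD := derivation_twisted lc b Up.
have uJ := lc_unit lc Up.
pose DI : 'M[C]_n := \matrix_(i, c) twisted_dbar (phi_mx phi) b (fun x => invmx (J x) i c) p.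
suff /matrixP/(_ i j) : DI = - (phi_dz (phi_mx phi) b p *m invmx (J p)) by rewrite !mxE.
apply: (can_inj (mulmxK uJ)); rewrite mulNmx mulmxKV//.
apply/eqP; rewrite -addr_eq0; apply/eqP.
have -> : phi_dz (phi_mx phi) b p = invmx (J p) *m (J p *m phi_dz (phi_mx phi) b p).
  by rewrite mulKmx.
apply/matrixP => k a; rewrite [RHS]mxE.
apply: (@etrans _ _ (twisted_dbar (phi_mx phi) b
    (fun x => \sum_c invmx (J x) k c * J x c a) p)).
  rewrite (der_sum oU dD); last first.
    move=> c _; apply: smoothCM => //; [exact: smoothC_invmx_dz_mx|exact: smoothC_dz_mx].
  rewrite mxE [X in X + _]mxE [X in _ + X]mxE -big_split; apply: eq_bigr => c _ /=.
  rewrite (derM dD); [|exact: smoothC_invmx_dz_mx|exact: smoothC_dz_mx].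
  by rewrite (twisted_dz_mx lc)// [in LHS]mxE.
apply: etrans (der_cst dD (1%:M k a)); apply: (der_eq dD) => x Ux.
by rewrite -(mulVmx (lc_unit lc Ux)) [RHS]mxE.
Qed.

(** The representation of J trivializes the connection: its derivative along D_b reproduces exactly
    the [conn] term of [cov]. *)
Lemma twisted_tensor_mx E b (s : tidx n E -> Cn R n -> C) e p : U p ->
  (forall e', smoothC_on U (s e')) ->
  twisted_dbar (phi_mx phi) b (fun x => \sum_e' tensor_mx (J x) e e' * s e' x) p =
  \sum_e' tensor_mx (J p) e e' * cov phi b s e' p.
Proof.
move=> Up ss; have dD := derivation_twisted lc b Up.
have st e1 e2 : smoothC_on U (fun x => tensor_mx (J x) e1 e2 (E := E)).
  apply: smoothC_tensor_mx => //; [exact: smoothC_dz_mx|exact: smoothC_invmx_dz_mx].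
rewrite (der_sum oU dD); last by move=> e' _; exact: smoothCM.
under eq_bigr do rewrite (derM dD) //.
under [RHS]eq_bigr do rewrite mulrDr mulr_sumr.
rewrite !big_split /= addrC; congr (_ + _).
rewrite exchange_big /=; apply: eq_bigr => e' _.
rewrite (der_tensor_mx e e' oU dD smoothC_dz_mx smoothC_invmx_dz_mx
  (fun i j => twisted_dz_mx lc b i j Up) (fun i j => twisted_invmx_dz_mx b i j Up)).
by rewrite mulr_suml; apply: eq_bigr => e'' _; rewrite mulrA.
Qed.

(** The local form of the theorem. Contracting the bundle index with J first leaves scalar
    components [F], to which [dolbeault_pullback] applies; [twisted_tensor_mx] then moves D_b past J
    and produces the covariant derivatives of [delbar_ang]. *)
Lemma delbar_act E q (s : tform R n E q) B e x : V x ->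
  (forall B' e', smoothC_on U (s B' e')) ->
  (forall e', alternating (fun B' => s B' e' (z x))) ->
  delbar (fun B e y => act (N y) (J (z y)) (fun B' e' => s B' e' (z y)) B e) B e x =
  act (N x) (J (z x))
    (fun B' e' => delbar s B' e' (z x) - ang phi s B' e' (z x)) B e.
Proof.
move=> Vx ss alts.
pose F (B' : {ffun 'I_q -> 'I_n}) p : C := \sum_e' tensor_mx (J p) e e' * s B' e' p.
have actF y B0 : act (N y) (J (z y)) (fun B' e' => s B' e' (z y)) B0 e =
    \sum_(B' : {ffun 'I_q -> 'I_n}) (\prod_l N y (B' l) (B0 l)) * F B' (z y).
  by apply: eq_bigr => B' _; rewrite mulr_sumr; apply: eq_bigr => e' _; rewrite mulrA.
have st e1 e2 : smoothC_on U (fun x => tensor_mx (J x) e1 e2 (E := E)).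
  apply: smoothC_tensor_mx => //; [exact: smoothC_dz_mx|exact: smoothC_invmx_dz_mx].
have sF B' : smoothC_on U (F B').
  by apply: smoothC_sum => // e' _; exact: smoothCM.
have altF : alternating (fun B' => F B' (z x)).
  apply/alternatingE => t B'; rewrite mulr_sumr; apply: eq_bigr => e' _.
  by rewrite ((alternatingE _).1 (alts e')) mulrCA.
apply: etrans (etrans (dolbeault_pullback lc B Vx sF altF) _).
  apply: eq_bigr => k _; congr (_ * _).
  by apply: (f_equal (fun f => dzbar (B k) f x)); apply/funext => y; exact: actF.
apply: eq_bigr => B' _.
under [RHS]eq_bigr do rewrite delbar_ang -mulrA.
rewrite -mulr_sumr; congr (_ * _).
under eq_bigr do rewrite (twisted_tensor_mx _ _ (lc_zU lc Vx))// mulr_sumr.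
rewrite exchange_big; apply: eq_bigr => e' _ /=.
by rewrite mulr_sumr; apply: eq_bigr => k _; rewrite mulrCA.
Qed.

End TensorPullback.

(** * Atlases *)

(** Inside [cod i] the overlap is the preimage of [dom j] under [inv i]. The conditions are listed
    one by one so that the lemma also covers [prod_atlas]. *)
Lemma open_overlap (R : realType) (X : topologicalType) n (A A' : atlas R X n)
    (i : idx A) (j : idx A') :
  open (cod i) -> (forall x, dom i x -> inv i (chart i x) = x) ->
  (forall z, cod i z -> {for z, continuous (inv i)}) -> open (dom j) ->
  open (overlap i j).
Proof.
move=> oi iK ci oj.
have -> : overlap i j = cod i `&` (inv i @^-1` dom j).
  apply/seteqP; split=> p.
    by case=> x [xi xj] <-; split; [exists x|rewrite /= iK].
  by case=> [[x xi <-]] /=; rewrite iK// => xj; exists x.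
rewrite openE => p [ip jp]; apply: filterI; first exact: open_nbhs_nbhs.
by apply: (ci _ ip); apply: open_nbhs_nbhs; split.
Qed.

Section Overlaps.
Variables (R : realType) (X : topologicalType) (n : nat).
Local Notation C := (Cplx R).
Implicit Types A : atlas R X n.

Lemma overlap_open S S' A A' (hA : complex_atlas S A) (hA' : complex_atlas S' A')
  (i : idx A) (j : idx A') : open (overlap i j).
Proof.
apply: open_overlap; [exact: (atlas_cod_open hA)|exact: (atlas_invK hA)| |].
  exact: (atlas_inv_cont hA).
exact: (atlas_dom_open hA').
Qed.

Lemma trans_chart S A A' (hA : complex_atlas S A) (i : idx A) (j : idx A') x :
  dom i x -> trans i j (chart i x) = chart j x.
Proof. by move=> xi; rewrite /trans /= (atlas_invK hA xi). Qed.

Lemma overlap_chart A A' (i : idx A) (j : idx A') x :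
  dom i x -> dom j x -> overlap i j (chart i x).
Proof. by move=> xi xj; exists x. Qed.

Section Chain.
Variables (A1 A2 A3 : atlas R X n).
Hypotheses (h1 : complex_atlas [set: X] A1) (h2 : complex_atlas [set: X] A2)
  (h3 : complex_atlas [set: X] A3).
Variables (i : idx A1) (j : idx A2) (k : idx A3).
Hypotheses (s12 : smooth_on (overlap i j) (trans i j))
  (s23 : smooth_on (overlap j k) (trans j k)).

(** The Wirtinger chain rule has a second term, a product of the antiholomorphic derivatives of both
    changes; holomorphy of either one removes it. *)
Lemma jac_comp x : dom i x -> dom j x -> dom k x ->
  jacbar i j (chart i x) = 0 \/ jacbar j k (chart j x) = 0 ->
  jac i k (chart i x) = jac j k (chart j x) *m jac i j (chart i x).
Proof.
move=> xi xj xk hol.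
(* The direct and the composed change of charts agree on this triple overlap. *)
pose W : set (Cn R n) := overlap i j `&` overlap i k.
have oW : open W by apply: openI; [exact: (overlap_open h1 h2)|exact: (overlap_open h1 h3)].
have Wx : W (chart i x) by split; exact: overlap_chart.
have WE p : W p -> overlap j k (trans i j p) /\ trans i k p = trans j k (trans i j p).
  move=> [[y [yi yj] <-] [y' [y'i y'k] E]].
  have yy' : y = y' by rewrite -(atlas_invK h1 yi) -E (atlas_invK h1 y'i).
  rewrite -yy' in y'k; rewrite !(trans_chart h1)// (trans_chart h2)//.
  by split=> //; exact: overlap_chart.
apply/matrixP => c a; rewrite mxE [RHS]mxE.
have sc : smoothC_on (overlap j k) (coord c \o trans j k).
  by apply: smoothC_coord s23; exact: (overlap_open h2 h3).
have sW : smooth_on W (trans i j).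
  by move=> m; apply: Ck_sub (s12 m) => p [].
apply: etrans (_ : _ = dz a (fun p => (coord c \o trans j k) (trans i j p)) (chart i x)) _.
  by apply: (der_eq (derivation_dz a oW Wx)) => p /WE[_ /= ->].
rewrite (dz_comp a Wx (WE _ Wx).1 sW sc) big_split /= [X in _ + X]big1 ?addr0.
  apply: eq_bigr => b _; rewrite !mxE mulrC; congr (_ * _).
  by rewrite (trans_chart h1).
move=> b _; rewrite (trans_chart h1)//.
case: hol => [/matrixP/(_ b a)|/matrixP/(_ c b)]; rewrite !mxE => ->.
  by rewrite rmorph0 mul0r.
by rewrite mulr0.
Qed.

End Chain.

Lemma jac_id A (hA : complex_atlas [set: X] A) (i : idx A) x : dom i x ->
  jac i i (chart i x) = 1%:M.
Proof.
move=> xi; apply/matrixP => c a; rewrite mxE [RHS]mxE; apply: etrans (dz_coord a c (chart i x)).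
have Ux := overlap_chart xi xi.
have oO : open (overlap i i) by exact: (overlap_open hA hA).
have dD := derivation_dz a oO Ux; apply: (der_eq dD) => p [y [yi _] <-] /=.
by rewrite (trans_chart hA).
Qed.

Section HolomorphicAtlas.
Variable A : atlas R X n.
Hypothesis hA : complex_atlas [set: X] A.

Lemma atlas_smooth (i i' : idx A) : smooth_on (overlap i i') (trans i i').
Proof. by have [[]] := atlas_holo hA i i'. Qed.

Lemma atlas_jacbar (i i' : idx A) x : dom i x -> dom i' x ->
  jacbar i i' (chart i x) = 0.
Proof.
move=> xi xi'; have [[_ H] _] := atlas_holo hA i i'.
by apply/matrixP => k a; rewrite !mxE; apply: H; exact: overlap_chart.
Qed.

Lemma atlas_jac_unit (i i' : idx A) x : dom i x -> dom i' x ->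
  jac i i' (chart i x) \in unitmx.
Proof.
move=> xi xi'.
have := jac_comp hA hA hA (@atlas_smooth i i') (@atlas_smooth i' i) xi xi' xi
  (or_introl (atlas_jacbar xi xi')).
by rewrite (jac_id hA xi) => /esym/mulmx1_unit[].
Qed.

Definition zero_tform : tform R n Tangent 1 := fun _ _ _ => 0.

Lemma phi_mx_zero p : phi_mx zero_tform p = 0.
Proof. by apply/matrixP => a b; rewrite !mxE. Qed.

Lemma atlas_local_change (i i' : idx A) :
  local_change (overlap i i') (overlap i' i) (trans i i') (trans i' i)
    (phi_mx zero_tform).
Proof.
split.
- exact: (overlap_open hA hA).
- exact: (overlap_open hA hA).
- by move=> _ [x [xi xj] <-]; rewrite (trans_chart hA)//; exact: overlap_chart.
- by move=> _ [x [xi xj] <-]; rewrite (trans_chart hA)//; exact: overlap_chart.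
- by move=> _ [x [xi xj] <-]; rewrite !(trans_chart hA).
- by move=> _ [x [xi xj] <-]; rewrite !(trans_chart hA).
- exact: atlas_smooth.
- exact: atlas_smooth.
- by move=> a b; rewrite phi_mxE; exact: smoothC_cst.
- by move=> _ [x [xi xj] <-]; exact: atlas_jac_unit.
- by move=> _ [x [xi xj] <-]; rewrite phi_mx_zero mulmx0 -(atlas_jacbar xi xj).
Qed.

End HolomorphicAtlas.

Section Beltrami.
Variables (A A' : atlas R X n) (phi : cochain A Tangent 1).
Hypotheses (hA : complex_atlas [set: X] A) (hA' : complex_atlas [set: X] A')
  (hs : smooth_compatible A A') (hphi : beltrami A' phi).

Lemma beltrami_local_change (i : idx A) (j : idx A') :
  local_change (overlap i j) (overlap j i) (trans i j) (trans j i) (phi_mx (phi i)).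
Proof.
split.
- exact: (overlap_open hA hA').
- exact: (overlap_open hA' hA).
- by move=> _ [x [xi xj] <-]; rewrite (trans_chart hA)//; exact: overlap_chart.
- by move=> _ [x [xi xj] <-]; rewrite (trans_chart hA')//; exact: overlap_chart.
- by move=> _ [x [xi xj] <-]; rewrite (trans_chart hA)// (trans_chart hA').
- by move=> _ [x [xi xj] <-]; rewrite (trans_chart hA')// (trans_chart hA).
- exact: (hs i j).1.
- exact: (hs i j).2.
- move=> a b; rewrite phi_mxE; apply: smoothC_sub (form_smooth (beltrami_form hphi) i _ a).
  by move=> _ [x [xi xj] <-]; exists x.
- by move=> _ [x [xi xj] <-]; exact: (beltrami_unit hphi).
- move=> _ [x [xi xj] <-]; have uJ := beltrami_unit hphi xi xj.
  rewrite (_ : phi_mx _ _ = invmx (jac i j (chart i x)) *m jacbar i j (chart i x)).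
    by rewrite mulKVmx.
  by apply/matrixP => a b; rewrite mxE (beltrami_eq hphi xi xj).
Qed.

End Beltrami.
End Overlaps.

(** * The Dolbeault complex *)

Section DolbeaultComplex.
Variables (R : realType) (X : topologicalType) (n : nat) (E : tensor_bundle).
Local Notation C := (Cplx R).
Variable A : atlas R X n.
Hypothesis hA : complex_atlas [set: X] A.

Definition conj_invmx (g : 'M[C]_n) : 'M[C]_n := map_mx Num.conj (invmx g).

Lemma form_transE q (s : cochain A E q) i j x B e : forms s ->
  dom i x -> dom j x ->
  s j B e (chart j x) = act (conj_invmx (jac i j (chart i x))) (jac i j (chart i x))
    (fun B' e' => s i B' e' (chart i x)) B e.
Proof.
move=> sf xi xj; rewrite (form_trans sf xi xj).
apply: eq_bigr => B' _; apply: eq_bigr => e' _; congr (_ * _ * _).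
by apply: eq_bigr => k _; rewrite mxE.
Qed.

Lemma forms_lin q (a : C) (s s' : cochain A E q) : forms s -> forms s' ->
  forms (a *: s + s').
Proof.
move=> sf sf'; split.
- move=> i B e; apply: smoothCD; [exact: (atlas_cod_open hA)| |exact: form_smooth].
  apply: smoothCM; [exact: (atlas_cod_open hA)|exact: smoothC_cst|exact: form_smooth].
- move=> i e z; apply: alternating_lin; exact: form_alt.
- move=> i B z; apply: in_fiber_lin; exact: form_fiber.
- move=> i B e z Hz; rewrite -[LHS]/(a * s i B e z + s' i B e z).
  by rewrite (form_off sf)// (form_off sf')// mulr0 addr0.
- move=> i j x xi xj B e; rewrite -[LHS]/(a * s j B e (chart j x) + s' j B e (chart j x)).
  rewrite (form_trans sf xi xj) (form_trans sf' xi xj) mulr_sumr -big_split.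
  apply: eq_bigr => B' _; rewrite mulr_sumr -big_split; apply: eq_bigr => e' _ /=.
  by rewrite -[in RHS]/(a * s i B' e' (chart i x) + s' i B' e' (chart i x)) mulrDr mulrCA.
Qed.

Lemma forms0 q : forms (0 : cochain A E q).
Proof.
split.
- by move=> i B e; exact: smoothC_cst.
- by move=> i e z s I; rewrite oppr0 if_same.
- by move=> i B z; exact: in_fiber0.
- by [].
- move=> i j x xi xj B e; rewrite big1// => B' _; rewrite big1// => e' _.
  by rewrite mulr0.
Qed.

Lemma form_smooth_overlap q (s : cochain A E q) (A' : atlas R X n) i (j : idx A') B e :
  forms s -> smoothC_on (overlap i j) (s i B e).
Proof.
move=> sf; apply: smoothC_sub (form_smooth sf i B e).
by move=> _ [x [xi _] <-]; exists x.
Qed.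

Lemma globalize_cod q D (s : cochain A E q) i B e x : dom i x ->
  globalize D s i B e (chart i x) = D i (s i) B e (chart i x).
Proof.
by move=> xi; rewrite /globalize; case: asboolP => // H; exfalso; apply: H; exists x.
Qed.

Local Notation dbar := (globalize (fun=> @delbar R n E _)).

Lemma delbar_alternating q (s : tform R n E q) e p :
  (forall z, alternating (fun B => s B e z)) ->
  (forall B a, dzbar a (fun z => - s B e z) p = - dzbar a (s B e) p) ->
  alternating (fun B => delbar s B e p).
Proof.
move=> alts dN.
apply: (alternating_dsum (u := fun a C => dzbar a (s C e) p)) => a t I.
case: (boolP (odd_perm t)) => ot.
  rewrite -dN; apply: (f_equal (fun f => dzbar a f p)); apply/funext => z.
  by rewrite alts ot.
apply: (f_equal (fun f => dzbar a f p)); apply/funext => z.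
by rewrite alts (negbTE ot).
Qed.

Lemma dzbarN_form q (s : cochain A E q) i B e a p : forms s -> cod i p ->
  dzbar a (fun z => - s i B e z) p = - dzbar a (s i B e) p.
Proof.
move=> sf ip; have oi : open (cod i) by exact: (atlas_cod_open hA).
exact: (derN (derivation_dzbar a oi ip) (form_smooth sf i B e)).
Qed.

Lemma smooth_delbar q (s : cochain A E q) i B e : forms s ->
  smoothC_on (cod i) (delbar (s i) B e).
Proof.
move=> sf; have oi : open (cod i) by exact: (atlas_cod_open hA).
apply: smoothC_sum => // k _; apply: smoothCM => //; first exact: smoothC_cst.
by apply: smoothC_dzbar => //; exact: form_smooth.
Qed.

Lemma jac_conj_invmx (i j : idx A) x : dom i x -> dom j x ->
  map_mx Num.conj (jac j i (chart j x)) = conj_invmx (jac i j (chart i x)).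
Proof.
move=> xi xj; congr map_mx.
have uJ := atlas_jac_unit hA xi xj.
have := jac_comp hA hA hA (atlas_smooth hA i j) (atlas_smooth hA j i) xi xj xi
  (or_introl (atlas_jacbar hA xi xj)).
by rewrite (jac_id hA xi) => /(congr1 (mulmx^~ (invmx (jac i j (chart i x)))));
  rewrite mul1mx mulmxK.
Qed.

(** For phi = 0 the covariant derivative is [dzbar], so [delbar_ang] equates [delbar - ang] with
    [delbar]. *)
Lemma ang_zero q (s : tform R n E q) B e p : ang (@zero_tform R n) s B e p = 0.
Proof.
have := delbar_ang (@zero_tform R n) s B e p.
have covE b f : cov (@zero_tform R n) b f e p = dzbar b (f e) p.
  rewrite /cov /twisted_dbar big1 ?subr0; last by move=> a _; rewrite phi_mx_zero mxE mul0r.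
  rewrite big1 ?addr0// => e' _.
  rewrite (_ : phi_dz _ _ _ = 0) ?conn0 ?mul0r//.
  by apply/matrixP => c a; rewrite mxE phi_mxE mxE; exact: dz_cst.
under eq_bigr do rewrite covE.
by move/eqP; rewrite subr_eq addrC -subr_eq subrr eq_sym => /eqP.
Qed.

Lemma forms_dbar q (s : cochain A E q) : forms s -> forms (dbar s : cochain A E q.+1).
Proof.
move=> sf; split.
- move=> i B e; have oi : open (cod i) by exact: (atlas_cod_open hA).
  apply: smoothC_eq (smooth_delbar i B e sf) => // p ip.
  by rewrite /globalize; case: asboolP.
- move=> i e p; rewrite /globalize; case: asboolP => ip; last first.
    by move=> t I; rewrite oppr0 if_same.
  apply: delbar_alternating => [z|B a]; first exact: form_alt.
  exact: dzbarN_form.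
- move=> i B p; rewrite /globalize; case: asboolP => ip; last exact: in_fiber0.
  apply: in_fiber_sum => k _.
  apply: (in_fiber_odd (c := fun e z => s i (omit k B) e z)
     (L := fun f => dzbar (B k) f p)) => [e|z]; first exact: dzbarN_form.
  exact: form_fiber.
- by move=> i B e p ip; rewrite /globalize; case: asboolP.
- move=> i j x xi xj B e.
  rewrite globalize_cod//.
  have lc := atlas_local_change hA i j.
  have Vx : overlap j i (chart j x) by exact: overlap_chart.
  have oV := lc_openV lc.
  have zx : trans j i (chart j x) = chart i x by exact: (trans_chart hA).
  (* The transition law of the derivative is the local intertwining for two charts of the same
     atlas, with phi = 0. *)
  have := delbar_act lc B e Vx (fun B' e' => form_smooth_overlap i j B' e' sf)
    (fun e' => form_alt sf i e' _).
  rewrite zx => H.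
  transitivity (act (conj_invmx (jac i j (chart i x))) (jac i j (chart i x))
     (fun B' e' => dbar s i B' e' (chart i x)) B e); last first.
    apply: eq_bigr => B' _; apply: eq_bigr => e' _; congr (_ * _ * _).
    by apply: eq_bigr => k _; rewrite mxE.
  rewrite -(jac_conj_invmx xi xj).
  apply: etrans (etrans H _).
    apply: eq_bigr => k _; congr (_ * _).
    apply: (der_eq (derivation_dzbar (B k) oV Vx)) => _ [y [yj yi] <-].
    rewrite (form_transE _ _ sf yi yj) (trans_chart hA)//.
    by rewrite -(jac_conj_invmx yi yj).
  apply: eq_bigr => B' _; apply: eq_bigr => e' _; congr (_ * _).
  by rewrite globalize_cod// ang_zero subr0.
Qed.

Lemma dbar_lin q (a : C) (s s' : cochain A E q) : forms s -> forms s' ->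
  dbar (a *: s + s') = a *: dbar s + dbar s' :> cochain A E q.+1.
Proof.
move=> sf sf'; apply/funext => i; apply/funext => B; apply/funext => e; apply/funext => p.
rewrite -[RHS]/(a * dbar s i B e p + dbar s' i B e p) /globalize.
case: asboolP => ip; last by rewrite mulr0 addr0.
have oi : open (cod i) by exact: (atlas_cod_open hA).
rewrite mulr_sumr -big_split; apply: eq_bigr => k _ /=.
have dD := derivation_dzbar (B k) oi ip.
have ss := form_smooth sf i (omit k B) e; have ss' := form_smooth sf' i (omit k B) e.
have alg (c x y : C) : c * (a * x + y) = a * (c * x) + c * y by rewrite mulrDr mulrCA.
apply: etrans (alg _ _ _); apply: (f_equal (fun u => (-1) ^+ k * u)).
rewrite -(der_scale dD a ss) -(derD dD)//.
by apply: smoothCM => //; exact: smoothC_cst.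
Qed.

(** The second derivatives are symmetric in the two removed slots, so the signed double sum vanishes
    by [sum_lift_sym]. *)
Lemma dbarK q (s : cochain A E q) : forms s -> dbar (dbar s) = 0 :> cochain A E q.+2.
Proof.
move=> sf; apply/funext => i; apply/funext => B; apply/funext => e; apply/funext => p.
rewrite -[RHS]/(0 : C) {1}/globalize; case: asboolP => // ip.
have oi : open (cod i) by exact: (atlas_cod_open hA).
have ss B' := form_smooth sf i B' e.
rewrite -[RHS](@sum_lift_sym C q (fun k l =>
   dzbar (B k) (dzbar (B (lift k l)) (s i (remove_at l (remove_at k B)) e)) p)); last first.
  move=> k l k' l' H H'; rewrite H H' (remove_at2 B H H').
  exact: (dzbar_comm oi ip (ss _)).
apply: eq_bigr => k _.
have dD := derivation_dzbar (B k) oi ip.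
have sd l : smoothC_on (cod i) (dzbar (omit k B l) (s i (omit l (omit k B)) e)).
  exact: smoothC_dzbar.
apply: (@etrans _ _ ((-1) ^+ k * dzbar (B k) (delbar (s i) (omit k B) e) p)).
  apply: (f_equal (fun u => (-1) ^+ k * u)); apply: (der_eq dD) => x ix.
  by rewrite /globalize; case: asboolP.
rewrite (der_sum oi dD); last first.
  by move=> l _; apply: smoothCM => //; exact: smoothC_cst.
rewrite mulr_sumr; apply: eq_bigr => l _.
apply: etrans (f_equal (fun u => (-1) ^+ k * u) (der_scale dD ((-1) ^+ l) (sd l))) _.
have -> : omit k B l = B (lift k l) by rewrite ffunE.
by rewrite mulrA -exprD.
Qed.

Lemma dolbeault_is_complex : is_complex (dolbeault_complex A E).
Proof.
split=> /=.
- exact: forms0.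
- exact: forms_lin.
- exact: forms_dbar.
- exact: dbar_lin.
- exact: dbarK.
Qed.

End DolbeaultComplex.

(** * Transporting forms between atlases *)

Lemma map_conj_mulmx (R : realType) n (g h : 'M[Cplx R]_n) :
  map_mx Num.conj (g *m h) = map_mx Num.conj g *m map_mx Num.conj h.
Proof. exact: map_mxM. Qed.

Lemma conj_unitmx (R : realType) n (g : 'M[Cplx R]_n) :
  (map_mx Num.conj g \in unitmx) = (g \in unitmx).
Proof. exact: map_unitmx. Qed.

Lemma conj_invmx_unit (R : realType) n (g : 'M[Cplx R]_n) :
  (conj_invmx g \in unitmx) = (g \in unitmx).
Proof. by rewrite conj_unitmx unitmx_inv. Qed.

Section Gluing.
Variables (R : realType) (X : topologicalType) (n : nat).
Local Notation C := (Cplx R).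

(* Isomorphisms from the bundle of antiholomorphic covectors, resp. from the
   holomorphic tangent bundle, of A to that of A', expressed in the charts. *)
Record gluing (A A' : atlas R X n) (P Q : idx A -> idx A' -> X -> 'M[C]_n) : Prop :=
  Gluing {
  gl_unitP : forall i j x, dom i x -> dom j x -> P i j x \in unitmx;
  gl_unitQ : forall i j x, dom i x -> dom j x -> Q i j x \in unitmx;
  gl_leftP : forall i i' j x, dom i x -> dom i' x -> dom j x ->
    P i j x = conj_invmx (jac i i' (chart i x)) *m P i' j x;
  gl_leftQ : forall i i' j x, dom i x -> dom i' x -> dom j x ->
    Q i j x = Q i' j x *m jac i i' (chart i x);
  gl_rightP : forall i j j' x, dom i x -> dom j x -> dom j' x ->
    P i j' x = P i j x *m conj_invmx (jac j j' (chart j x));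
  gl_rightQ : forall i j j' x, dom i x -> dom j x -> dom j' x ->
    Q i j' x = jac j j' (chart j x) *m Q i j x;
  gl_smoothP : forall i j a b, smoothC_on (overlap j i) (fun y => P i j (inv j y) a b);
  gl_smoothQ : forall i j a b, smoothC_on (overlap j i) (fun y => Q i j (inv j y) a b);
  gl_smoothQV : forall i j a b,
    smoothC_on (overlap j i) (fun y => invmx (Q i j (inv j y)) a b) }.

(** The cocycle laws invert formally. Smoothness is supplied separately, because it now has to hold
    in the charts of [A]. *)
Lemma gluing_inv (A A' : atlas R X n) (P Q : idx A -> idx A' -> X -> 'M[C]_n)
    (hA : complex_atlas [set: X] A) (hA' : complex_atlas [set: X] A') :
  gluing P Q ->
  (forall i j a b, smoothC_on (overlap i j) (fun y => invmx (P i j (inv i y)) a b)) ->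
  (forall i j a b, smoothC_on (overlap i j) (fun y => Q i j (inv i y) a b)) ->
  (forall i j a b, smoothC_on (overlap i j) (fun y => invmx (Q i j (inv i y)) a b)) ->
  gluing (fun j i x => invmx (P i j x)) (fun j i x => invmx (Q i j x)).
Proof.
move=> g sP sQ sQV; split=> //.
- by move=> j i x xj xi; rewrite unitmx_inv (gl_unitP g).
- by move=> j i x xj xi; rewrite unitmx_inv (gl_unitQ g).
- move=> j j' i x xj xj' xi; have uJ := atlas_jac_unit hA' xj xj'.
  rewrite (gl_rightP g xi xj xj') invmx_mul ?conj_invmx_unit ?(gl_unitP g)//.
  by rewrite mulKVmx// conj_invmx_unit.
- move=> j j' i x xj xj' xi; have uJ := atlas_jac_unit hA' xj xj'.
  by rewrite (gl_rightQ g xi xj xj') invmx_mul ?(gl_unitQ g)// mulmxKV.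
- move=> j i i' x xj xi xi'; have uJ := atlas_jac_unit hA xi xi'.
  rewrite (gl_leftP g xi xi' xj) invmx_mul ?conj_invmx_unit ?(gl_unitP g)//.
  by rewrite mulmxKV// conj_invmx_unit.
- move=> j i i' x xj xi xi'; have uJ := atlas_jac_unit hA xi xi'.
  by rewrite (gl_leftQ g xi xi' xj) invmx_mul ?(gl_unitQ g)// mulKVmx.
- move=> j i a b; have := sQ i j a b; congr smoothC_on; apply/funext => y.
  by rewrite invmxK.
Qed.

Section Push.
Variables (E : tensor_bundle) (A A' : atlas R X n).
Hypotheses (hA : complex_atlas [set: X] A) (hA' : complex_atlas [set: X] A').
Hypothesis hs : smooth_compatible A A'.
Variables (P Q : idx A -> idx A' -> X -> 'M[C]_n).
Hypothesis g : gluing P Q.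

Lemma atlas_index (x : X) : exists i : idx A, dom i x.
Proof.
have : [set: X] x by [].
by rewrite -(atlas_cover hA) => -[i _ xi]; exists i.
Qed.

(* By [pushE] the arbitrary choice of a chart of A around each point does not
   matter on [forms]. *)
Definition push q (s : cochain A E q) : cochain A' E q := fun j B e y =>
  if `[< cod j y >] then
    let x := inv j y in let i := sval (cid (atlas_index x)) in
    act (P i j x) (Q i j x) (fun B' e' => s i B' e' (chart i x)) B e
  else 0.

Lemma push_lin q a (s s' : cochain A E q) : push (a *: s + s') = a *: push s + push s'.
Proof.
apply/funext => j; apply/funext => B; apply/funext => e; apply/funext => y.
rewrite -[RHS]/(a * push s j B e y + push s' j B e y) /push.
case: asboolP => jy; last by rewrite mulr0 addr0.
rewrite /act mulr_sumr -big_split; apply: eq_bigr => B' _ /=.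
rewrite mulr_sumr -big_split; apply: eq_bigr => e' _ /=.
by rewrite mulrCA -mulrDr.
Qed.

Lemma pushE q (s : cochain A E q) i j x B e : forms s -> dom i x -> dom j x ->
  push s j B e (chart j x) = act (P i j x) (Q i j x) (fun B' e' => s i B' e' (chart i x)) B e.
Proof.
move=> sf xi xj; rewrite /push; case: asboolP => [_|H]; last by exfalso; apply: H; exists x.
rewrite (atlas_invK hA' xj) /=; case: cid => k /= xk.
have uJ := atlas_jac_unit hA xk xi.
(* The Jacobians produced by replacing the chosen chart [k] with [i] are absorbed by the transition
   law of [s]. *)
rewrite (gl_leftP g xk xi xj) (gl_leftQ g xk xi xj) -actM ?(gl_unitQ g)//.
apply: eq_bigr => B' _; apply: eq_bigr => e' _; apply: (f_equal (fun u => _ * u)).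
by rewrite -(form_transE _ _ sf).
Qed.

Lemma push_forms q (s : cochain A E q) : forms s -> forms (push s).
Proof.
move=> sf; split.
(* The chart chosen in [push] may jump from point to point; near a given point [pushE] allows one
   fixed chart [i]. *)
- move=> j B e; apply: smoothC_local => _ [x xj <-].
  have [i xi] := atlas_index x.
  exists (overlap j i); first exact: overlap_chart.
  have oji : open (overlap j i) by exact: (overlap_open hA' hA).
  have : smoothC_on (overlap j i)
      (fun y => act (P i j (inv j y)) (Q i j (inv j y))
         (fun B' e' => s i B' e' (trans j i y)) B e).
    apply: (@smoothC_act _ _ _ E q (fun y => P i j (inv j y)) (fun y => Q i j (inv j y))
        (fun B' e' y => s i B' e' (trans j i y))) => //.
    + by move=> a b; exact: (gl_smoothP g).
    + by move=> a b; exact: (gl_smoothQ g).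
    + by move=> a b; exact: (gl_smoothQV g).
    + move=> B' e'; apply: (smoothC_comp oji _ (hs i j).2 (form_smooth_overlap i j B' e' sf)).
      by move=> _ [y [yj yi] <-]; rewrite (trans_chart hA')//; exact: overlap_chart.
  by apply: smoothC_eq => // _ [y [yj yi] <-]; rewrite (pushE _ _ sf yi yj)
    (atlas_invK hA' yj) (trans_chart hA').
- move=> j e y; rewrite /push; case: asboolP => jy; last by move=> t I; rewrite oppr0 if_same.
  apply: act_alternating => e'; exact: form_alt.
- move=> j B y; rewrite /push; case: asboolP => jy; last exact: in_fiber0.
  by apply: act_fiber => B'; exact: form_fiber.
- by move=> j B e y jy; rewrite /push; case: asboolP.
- move=> j j' x xj xj' B e; have [i xi] := atlas_index x.
  rewrite (pushE _ _ sf xi xj') (gl_rightP g xi xj xj') (gl_rightQ g xi xj xj').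
  have uJ := atlas_jac_unit hA' xj xj'.
  rewrite -actM ?(gl_unitQ g)//.
  apply: eq_bigr => B' _; apply: eq_bigr => e' _; rewrite (pushE _ _ sf xi xj).
  by congr (_ * _ * _); apply: eq_bigr => k _; rewrite mxE.
Qed.

End Push.
End Gluing.

Lemma conj_invmxE (R : realType) n (g : 'M[Cplx R]_n) :
  conj_invmx g = invmx (map_mx Num.conj g).
Proof. exact: map_invmx. Qed.

Lemma act_ext (R : realType) n E q (P Q : 'M[Cplx R]_n)
    (c c' : {ffun 'I_q -> 'I_n} -> tidx n E -> Cplx R) B e :
  (forall B e, c B e = c' B e) -> act P Q c B e = act P Q c' B e.
Proof.
by move=> cc'; apply: eq_bigr => B' _; apply: eq_bigr => e' _; rewrite cc'.
Qed.

(** * The deformed complex and its comparison with the Dolbeault complex of X_t *)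

Section Deformed.
Variables (R : realType) (X : topologicalType) (n : nat) (E : tensor_bundle).
Local Notation C := (Cplx R).
Variables (A A' : atlas R X n) (phi : cochain A Tangent 1).
Hypotheses (hA : complex_atlas [set: X] A) (hA' : complex_atlas [set: X] A')
  (hs : smooth_compatible A A') (hphi : beltrami A' phi).

Let lc i j := beltrami_local_change hA hA' hs hphi i j.

(** The matrix N, here a function of the point of X rather than of a coordinate, as [gluing] asks;
    [tangent_mx] is J likewise. *)
Definition dbar_mx (i : idx A) (j : idx A') (x : X) : 'M[C]_n :=
  map_mx Num.conj (jac j i (chart j x)).
Definition tangent_mx (i : idx A) (j : idx A') (x : X) : 'M[C]_n :=
  jac i j (chart i x).

Let conj_inv i j x : dom i x -> dom j x ->
  (map_mx Num.conj (jac i j (chart i x)) -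
   map_mx Num.conj (jacbar i j (chart i x)) *m phi_mx (phi i) (chart i x))
  *m dbar_mx i j x = 1%:M.
Proof.
move=> xi xj; have Vx : overlap j i (chart j x) by exact: overlap_chart.
by have := conj_dz_mx_inv (lc i j) Vx; rewrite (trans_chart hA').
Qed.

Let unitP i j x : dom i x -> dom j x -> dbar_mx i j x \in unitmx.
Proof. by move=> xi xj; have [_] := mulmx1_unit (conj_inv xi xj). Qed.

(** Each cocycle law is a chain rule between three charts, two of them from the same atlas. That
    change is holomorphic, so [jac_comp] applies although the change between the two atlases is
    merely smooth. *)
Lemma beltrami_gluing : gluing dbar_mx tangent_mx.
Proof.
split.
- exact: unitP.
- by move=> i j x xi xj; exact: (beltrami_unit hphi).
- move=> i i' j x xi xi' xj; rewrite /dbar_mx conj_invmxE.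
  have uJ := atlas_jac_unit hA xi xi'.
  rewrite (jac_comp hA' hA hA (hs i j).2 (atlas_smooth hA i i') xj xi xi'
    (or_intror (atlas_jacbar hA xi xi'))).
  by rewrite map_conj_mulmx mulKmx// conj_unitmx.
- move=> i i' j x xi xi' xj; rewrite /tangent_mx.
  exact: (jac_comp hA hA hA' (atlas_smooth hA i i') (hs i' j).1 xi xi' xj
    (or_introl (atlas_jacbar hA xi xi'))).
- move=> i j j' x xi xj xj'; rewrite /dbar_mx conj_invmxE.
  have uJ := atlas_jac_unit hA' xj xj'.
  rewrite (jac_comp hA' hA' hA (atlas_smooth hA' j j') (hs i j').2 xj xj' xi
    (or_introl (atlas_jacbar hA' xj xj'))).
  by rewrite map_conj_mulmx mulmxK// conj_unitmx.
- move=> i j j' x xi xj xj'; rewrite /tangent_mx.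
  exact: (jac_comp hA hA' hA' (hs i j).1 (atlas_smooth hA' j j') xi xj xj'
    (or_intror (atlas_jacbar hA' xj xj'))).
- move=> i j a b; have oji : open (overlap j i) by exact: (overlap_open hA' hA).
  apply: (smoothC_eq oji _ (smoothC_conj_dz_mx (lc i j) a b)) => _ [x [xj xi] <-].
  by rewrite /dbar_mx (atlas_invK hA' xj).
- move=> i j a b; have oji : open (overlap j i) by exact: (overlap_open hA' hA).
  exact: (smoothC_comp oji (lc_zU (lc i j)) (hs i j).2 (smoothC_dz_mx (lc i j) a b)).
- move=> i j a b; have oji : open (overlap j i) by exact: (overlap_open hA' hA).
  exact: (smoothC_comp oji (lc_zU (lc i j)) (hs i j).2 (smoothC_invmx_dz_mx (lc i j) a b)).
Qed.

Lemma beltrami_gluing_inv :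
  gluing (fun j i x => invmx (dbar_mx i j x)) (fun j i x => invmx (tangent_mx i j x)).
Proof.
apply: (gluing_inv hA hA' beltrami_gluing) => i j a b;
  have oij : open (overlap i j) by [exact: (overlap_open hA hA')].
- have sJ c d := smoothC_dz_mx (lc i j) c d.
  have sJb c d := smoothC_dzbar_mx (lc i j) c d.
  (* The explicit inverse of N from [conj_dz_mx_inv], a polynomial in smooth functions. *)
  have : smoothC_on (overlap i j) (fun p => (jac i j p a b)^* -
      \sum_c (jacbar i j p a c)^* * phi_mx (phi i) p c b).
    apply: smoothCB => //; first exact: smoothC_conj.
    apply: smoothC_sum => // c _; apply: smoothCM => //; first exact: smoothC_conj.
    exact: (lc_phi (lc i j)).
  apply: smoothC_eq => // _ [x [xi xj] <-]; rewrite (atlas_invK hA xi).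
  have -> : invmx (dbar_mx i j x) = map_mx Num.conj (jac i j (chart i x)) -
      map_mx Num.conj (jacbar i j (chart i x)) *m phi_mx (phi i) (chart i x).
    by apply: (can_inj (mulmxK (unitP xi xj))); rewrite mulVmx ?unitP// conj_inv.
  rewrite [RHS]mxE [X in _ = X + _]mxE [X in _ = _ + X]mxE [X in _ = _ - X]mxE.
  by congr (_ - _); apply: eq_bigr => c _; rewrite [X in _ = X * _]mxE.
- apply: (smoothC_eq oij _ (smoothC_dz_mx (lc i j) a b)) => _ [x [xi xj] <-].
  by rewrite /tangent_mx (atlas_invK hA xi).
- apply: (smoothC_eq oij _ (smoothC_invmx_dz_mx (lc i j) a b)) => _ [x [xi xj] <-].
  by rewrite /tangent_mx (atlas_invK hA xi).
Qed.

Local Notation fwd := (@push R X n E A A' hA dbar_mx tangent_mx _).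
Local Notation bwd := (@push R X n E A' A hA' (fun j i x => invmx (dbar_mx i j x))
  (fun j i x => invmx (tangent_mx i j x)) _).
Local Notation dbar := (globalize (fun=> @delbar R n E _)).
Local Notation dbar_phi :=
  (globalize (fun i s B e z => delbar s B e z - ang (phi i) s B e z)).

Let hs' : smooth_compatible A' A.
Proof. by move=> j i; split; [exact: (hs i j).2|exact: (hs i j).1]. Qed.

Let g := beltrami_gluing.
Let g' := beltrami_gluing_inv.

Lemma fwd_forms q (s : cochain A E q) : forms s -> forms (fwd s).
Proof. exact: push_forms. Qed.

Lemma bwd_forms q (s : cochain A' E q) : forms s -> forms (bwd s).
Proof. exact: push_forms. Qed.

Lemma fwdK q (s : cochain A E q) : forms s -> bwd (fwd s) = s.
Proof.
move=> sf; apply/funext => i; apply/funext => B; apply/funext => e; apply/funext => p.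
have [[x xi <-]|ip] := pselect (cod i p); last first.
  by rewrite (form_off (bwd_forms (fwd_forms sf)))// (form_off sf).
have [j xj] := atlas_index hA' x.
rewrite (pushE hA' hA g' _ _ (fwd_forms sf) xj xi).
rewrite (act_ext _ _ _ _ (fun B' e' => pushE hA hA' g B' e' sf xi xj)).
by rewrite actM ?unitmx_inv ?(gl_unitQ g)// mulmxV ?(gl_unitP g)// mulVmx ?(gl_unitQ g)// act1.
Qed.

Lemma bwdK q (s : cochain A' E q) : forms s -> fwd (bwd s) = s.
Proof.
move=> sf; apply/funext => j; apply/funext => B; apply/funext => e; apply/funext => p.
have [[x xj <-]|jp] := pselect (cod j p); last first.
  by rewrite (form_off (fwd_forms (bwd_forms sf)))// (form_off sf).
have [i xi] := atlas_index hA x.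
rewrite (pushE hA hA' g _ _ (bwd_forms sf) xi xj).
rewrite (act_ext _ _ _ _ (fun B' e' => pushE hA' hA g' B' e' sf xj xi)).
by rewrite actM ?unitmx_inv ?(gl_unitQ g)// mulVmx ?(gl_unitP g)// mulmxV ?(gl_unitQ g)// act1.
Qed.

Lemma delbar_fwd q (s : cochain A E q) i j x B e : forms s -> dom i x -> dom j x ->
  delbar (fwd s j) B e (chart j x) =
  act (dbar_mx i j x) (tangent_mx i j x) (fun B' e' => dbar_phi s i B' e' (chart i x)) B e.
Proof.
move=> sf xi xj.
have Vx : overlap j i (chart j x) by exact: overlap_chart.
have oji : open (overlap j i) by exact: (overlap_open hA' hA).
have zx : trans j i (chart j x) = chart i x by exact: (trans_chart hA').
have := delbar_act (lc i j) B e Vx (fun B' e' => form_smooth_overlap i j B' e' sf)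
  (fun e' => form_alt sf i e' _).
rewrite zx => H.
apply: etrans (etrans H _).
  apply: eq_bigr => k _; apply: (f_equal (fun u => (-1) ^+ k * u)).
  apply: (der_eq (derivation_dzbar (B k) oji Vx)) => _ [y [yj yi] <-].
  by rewrite (pushE hA hA' g _ _ sf yi yj) (trans_chart hA').
by apply: act_ext => B' e'; rewrite globalize_cod.
Qed.

(** Proved by evaluation in charts, since [dbar_phi s] is not yet known to be a form and [pushE]
    cannot be applied to it. That it is a form, and that [fwd] commutes with the operators, are
    consequences. *)
Lemma dbar_phiE q (s : cochain A E q) : forms s ->
  dbar_phi s = bwd (dbar (fwd s)) :> cochain A E q.+1.
Proof.
move=> sf; apply/funext => i; apply/funext => B; apply/funext => e; apply/funext => p.
have dsf := forms_dbar hA' (fwd_forms sf).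
have [[x xi <-]|ip] := pselect (cod i p); last first.
  by rewrite (form_off (bwd_forms dsf))// /globalize; case: asboolP.
have [j xj] := atlas_index hA' x.
rewrite (pushE hA' hA g' _ _ dsf xj xi).
rewrite (act_ext _ _ _ _ (fun B' e' =>
  etrans (globalize_cod _ _ _ _ xj) (delbar_fwd B' e' sf xi xj))).
by rewrite actM ?unitmx_inv ?(gl_unitQ g)// mulmxV ?(gl_unitP g)// mulVmx ?(gl_unitQ g)// act1.
Qed.

Lemma dbar_phi_forms q (s : cochain A E q) : forms s ->
  forms (dbar_phi s : cochain A E q.+1).
Proof.
by move=> sf; rewrite dbar_phiE//; apply: bwd_forms; exact/(forms_dbar hA')/fwd_forms.
Qed.

Lemma fwd_dbar_phi q (s : cochain A E q) : forms s ->
  fwd (dbar_phi s : cochain A E q.+1) = dbar (fwd s).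
Proof.
by move=> sf; rewrite dbar_phiE// bwdK//; exact/(forms_dbar hA')/fwd_forms.
Qed.

Lemma deformed_is_complex : is_complex (deformed_dolbeault_complex E phi).
Proof.
split=> /=.
- exact: forms0.
- exact: (forms_lin hA).
- exact: dbar_phi_forms.
- move=> q a s s' sf sf'; rewrite !dbar_phiE//; last exact: (forms_lin hA).
  by rewrite push_lin (dbar_lin hA') ?push_lin//; exact: fwd_forms.
- move=> q s sf; rewrite dbar_phiE; last exact: dbar_phi_forms.
  rewrite (fwd_dbar_phi sf) (dbarK hA' (fwd_forms sf)).
  (* Coefficient -1 at zero vectors turns linearity into [push 0 = 0]. *)
  have := push_lin hA' (fun j i x => invmx (dbar_mx i j x))
    (fun j i x => invmx (tangent_mx i j x)) (-1) (0 : cochain A' E q.+2) 0.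
  by rewrite scaler0 addr0 scaleN1r addNr.
Qed.

Lemma deformed_complex_iso :
  complex_iso (deformed_dolbeault_complex E phi) (dolbeault_complex A' E).
Proof.
exists (fun q s => fwd s); split=> /=.
- move=> q; split=> [s|s s'|s].
  + exact: fwd_forms.
  + by rewrite !inE => sf sf' /(congr1 (fun u => bwd u)); rewrite !fwdK.
  + by move=> sf; exists (bwd s); [exact: bwd_forms|exact: bwdK].
- by move=> q a s s' _ _; exact: push_lin.
- by move=> q s; exact: fwd_dbar_phi.
Qed.

End Deformed.

(** * Cohomology *)

Section CohomologyIso.
Variables (K : fieldType) (C C' : cochain_data K).
Hypotheses (hC : is_complex C) (hC' : is_complex C').

Lemma coboundaries_obj (D : cochain_data K) (hD : is_complex D) q b :
  coboundaries D q b -> obj D q b.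
Proof.
case: q b => [|q] b /=; first by move->; exact: (complex_0 hD).
by move=> [t tD <-]; exact: (complex_diff hD).
Qed.

(** Classes are cosets, so the induced map is the direct image. As [f] is controlled on [obj] only,
    cosets of cocycles must first be seen to lie in [obj]. *)
Lemma complex_iso_cohomology q : complex_iso C C' -> cohomology_iso C C' q.
Proof.
move=> [f [bf linf comf]].
have fF p s : obj C p s -> obj C' p (f p s) by have [+ _ _] := bf p; exact.
have finj p s s' : obj C p s -> obj C p s' -> f p s = f p s' -> s = s'.
  by have [_ + _] := bf p => + sC s'C; apply; rewrite inE.
have fsurj p t : obj C' p t -> exists2 s, obj C p s & f p s = t.
  by have [_ _ +] := bf p => /[apply].
have fD p s s' : obj C p s -> obj C p s' -> f p (s + s') = f p s + f p s'.
  by move=> sC s'C; have := linf p 1 s s' sC s'C; rewrite !scale1r.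
have f0 p : f p 0 = 0.
  have := linf p (-1) 0 0 (complex_0 hC p) (complex_0 hC p).
  by rewrite scaler0 addr0 scaleN1r addNr.
have fcob p b : coboundaries C p b -> coboundaries C' p (f p b).
  case: p b => [|p] b /=; first by move->; exact: f0.
  by move=> [t tC <-]; exists (f p t); [exact: fF|rewrite comf].
have fcob_surj p b : coboundaries C' p b -> exists2 b', coboundaries C p b' & f p b' = b.
  case: p b => [|p] b /=; first by move->; exists 0 => //; exact: f0.
  move=> [t /fsurj[t' t'C <-] <-]; exists (diff C p t'); first by exists t'.
  by rewrite comf.
have coset_obj u : cohomology C q u -> u `<=` obj C q.
  move=> [s [sC _] <-] _ [b /(coboundaries_obj hC) bC <-].
  by have := complex_lin hC 1 sC bC; rewrite scale1r.
have image_coset s : obj C q s -> f q @` [set s + b | b in coboundaries C q] =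
    [set f q s + b | b in coboundaries C' q].
  move=> sC; apply/seteqP; split=> t.
    move=> [_ [b bC <-] <-]; exists (f q b); first exact: fcob.
    by rewrite fD//; exact: coboundaries_obj bC.
  move=> [_ /fcob_surj[b bC <-] <-]; exists (s + b); first by exists b.
  by rewrite fD//; exact: coboundaries_obj bC.
exists (fun u => f q @` u); split; last first.
  move=> a u v /coset_obj uC /coset_obj vC; apply/seteqP; split=> t.
    move=> [_ [x xu [y yv <-]] <-]; exists (f q x); first by exists x.
    by exists (f q y); [exists y|rewrite linf//; [exact: uC|exact: vC]].
  move=> [_ [x xu <-] [_ [y yv <-] <-]]; exists (a *: x + y).
    by exists x => //; exists y.
  by rewrite linf//; [exact: uC|exact: vC].
split.
- move=> _ [s [sC ds] <-]; rewrite image_coset//; exists (f q s) => //.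
  by split; [exact: fF|rewrite -comf// ds f0].
- move=> u v; rewrite !inE => /coset_obj uC /coset_obj vC uv.
  apply/seteqP; split=> x xu.
    have : (f q @` v) (f q x) by rewrite -uv; exists x.
    by move=> [y yv /finj <-//]; [exact: vC|exact: uC].
  have : (f q @` u) (f q x) by rewrite uv; exists x.
  by move=> [y yv /finj <-//]; [exact: uC|exact: vC].
- move=> _ [t [/fsurj[s sC <-] dt] <-].
  exists [set s + b | b in coboundaries C q]; last exact: image_coset.
  exists s => //; split=> //.
  (* The preimage of a cocycle is a cocycle by injectivity of [f] one degree higher. *)
  apply: (finj q.+1); [exact: (complex_diff hC)|exact: (complex_0 hC)|].
  by rewrite comf// dt f0.
Qed.

End CohomologyIso.

(** * Fibers of a deformation *)

Section Fiber.
Variables (R : realType) (X : topologicalType) (n m : nat).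
Variables (A : atlas R X n) (B : set (Cn R m)) (F : atlas R (X * Cn R m)%type (n + m)).
Hypotheses (hA : complex_atlas [set: X] A) (hF : deformation A B F).
Variable t : Cn R m.
Hypothesis ht : B t.
Let h := deform_atlas hF.

Definition slice (z : Cn R n) : Cn R (n + m) := row_mx z t.

Lemma smooth_slice U : open U -> smooth_on U slice.
Proof.
move=> oU k; apply: (Ck_mx oU) => r c.
case: (split_ordP c) => c' ->.
  rewrite (_ : (fun x => _) = fun x => (x : 'M[R]_(2, n)) r c' : R^o).
    exact: (Ck_coord r c' oU (@smooth_id R (Cn R n) U k)).
  by apply/funext => z; rewrite row_mxEl.
rewrite (_ : (fun x => _) = cst (t r c' : R^o)); first exact: Ck_cst.
by apply/funext => z; rewrite row_mxEr.
Qed.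

Lemma continuous_slice : continuous slice.
Proof. by move=> z; exact: (smooth_slice openT 0%N). Qed.

Lemma smooth_lsubmx_slice U U' (T : Cn R (n + m) -> Cn R (n + m)) :
  open U -> open U' -> (forall z, U z -> U' (slice z)) -> smooth_on U' T ->
  smooth_on U (fun z => lsubmx (T (slice z)) : Cn R n).
Proof.
move=> oU oU' UU' sT k; apply: (Ck_mx oU) => r c.
have := Ck_comp oU UU' (smooth_slice oU k) (Ck_coord r (lshift m c) oU' (sT k)).
by congr (Ck _ _ _); apply/funext => z; rewrite mxE.
Qed.

Lemma chart_slice j x : dom j (x, t) ->
  slice (chart (a := fiber F t) j x) = chart (a := F) j (x, t).
Proof.
move=> xj; rewrite /slice /=.
by rewrite -[RHS]hsubmxK (deform_proj hF xj).
Qed.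

(** Charts of [F] keep the parameter as their last coordinates, so a point whose image lies on the
    slice at [t] belongs to X x {t}. *)
Lemma overlap_slice (i j : idx F) :
  overlap (A := fiber F t) (A' := fiber F t) i j = slice @^-1` overlap i j.
Proof.
apply/seteqP; split=> [_ [x [xi xj] <-]|z].
  by rewrite /preimage /mkset chart_slice//; exists (x, t).
move=> [[x t'] [pi pj] /= E].
have Et : t' = t.
  by have := deform_proj hF pi; rewrite E /slice row_mxKr.
rewrite Et in pi pj E; exists x; first by split.
by rewrite /= E row_mxKl.
Qed.

Lemma cod_slice (i : idx F) : cod (A := fiber F t) i = slice @^-1` cod i.
Proof.
apply/seteqP; split=> [_ [x xi <-]|z].
  by rewrite /preimage /mkset chart_slice//; exists (x, t).
move=> [[x t'] pi /= E].
have Et : t' = t.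
  by have := deform_proj hF pi; rewrite E /slice row_mxKr.
by rewrite Et in pi E; exists x => //=; rewrite E row_mxKl.
Qed.

Lemma continuous_pair_t : continuous (fun x : X => (x, t)).
Proof.
move=> x; have ct : cst t y @[y --> x] --> nbhs t by exact: cvg_cst.
exact: (cvg_pair (@cvg_id _ (nbhs x)) ct).
Qed.

Lemma fiber_holomorphic (i j : idx F) :
  holomorphic_on (overlap (A := fiber F t) (A' := fiber F t) i j)
    (trans (A := fiber F t) (A' := fiber F t) i j).
Proof.
have oF : open (overlap i j) by exact: (overlap_open h h).
have oU : open (overlap (A := fiber F t) (A' := fiber F t) i j).
  by rewrite overlap_slice; apply: open_comp => // z _; exact: continuous_slice.
have [[sT dT] _] := atlas_holo h i j.
have UU' z : overlap (A := fiber F t) (A' := fiber F t) i j z -> overlap i j (slice z).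
  by rewrite overlap_slice.
have TE z : overlap (A := fiber F t) (A' := fiber F t) i j z ->
    lsubmx (trans i j (slice z)) = trans (A := fiber F t) (A' := fiber F t) i j z.
  move=> [x [xi xj] <-]; rewrite chart_slice// (trans_chart h _ xi) /trans /=.
  by rewrite -/(slice _) (chart_slice xi) (atlas_invK h xi).
have sU := smooth_lsubmx_slice oU oF UU' sT.
split; first by move=> k; apply: Ck_eq (sU k) => // z /TE.
move=> z Uz a k.
apply: (@etrans _ _ (dzbar a (fun z => (coord (lshift m k) \o trans i j) (slice z)) z)).
  apply: (der_eq (derivation_dzbar a oU Uz)) => y /TE /= <-.
  by rewrite /coord !mxE.
rewrite (dzbar_comp a Uz (UU' _ Uz) (smooth_slice oU) (smoothC_coord _ oF sT)).
(* One term of the chain rule vanishes because the change of charts of [F] is holomorphic, the other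
   because the slice is. *)
apply: big1 => b _; rewrite (dT _ (UU' _ Uz)) mulr0 addr0.
suff -> : dzbar a (coord b \o slice) z = 0 by rewrite mul0r.
case: (split_ordP b) => b' ->.
  apply: etrans (dzbar_coord a b' z).
  by apply: (f_equal (fun f => dzbar a f z)); apply/funext => y; rewrite /coord /= !row_mxEl.
apply: etrans (dzbar_cst a (coord b' t) z).
by apply: (f_equal (fun f => dzbar a f z)); apply/funext => y; rewrite /coord /= !row_mxEr.
Qed.

Lemma fiber_complex_atlas : complex_atlas [set: X] (fiber F t).
Proof.
split=> /=.
- move=> i; apply: (@open_comp _ _ (fun x : X => (x, t)) (dom i)).
    by move=> x _; exact: continuous_pair_t.
  exact: (atlas_dom_open h).
- apply/seteqP; split=> // x _.
  have : ([set: X] `*` B) (x, t) by [].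
  by rewrite -(atlas_cover h) => -[i _ xi]; exists i.
- move=> i; rewrite cod_slice; apply: open_comp; last exact: (atlas_cod_open h).
  by move=> z _; exact: continuous_slice.
- move=> i x xi; have := chart_slice xi; rewrite /slice /= => ->.
  by rewrite (atlas_invK h xi).
- move=> i x xi.
  apply: (@continuous_comp _ _ _ (fun x => chart (a := F) i (x, t))
    (fun M : Cn R (n + m) => lsubmx M : Cn R n)).
    apply: (@continuous_comp _ _ _ (fun x : X => (x, t)) (chart (a := F) i)).
      exact: continuous_pair_t.
    exact: (atlas_chart_cont h xi).
  exact/differentiable_continuous/differentiable_lsubmx.
- move=> i z; rewrite cod_slice => zi.
  apply: (@continuous_comp _ _ _ (fun z => inv (a := F) i (slice z)) fst).
    apply: (@continuous_comp _ _ _ slice (inv (a := F) i)); first exact: continuous_slice.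
    exact: (atlas_inv_cont h zi).
  exact: cvg_fst.
- by move=> i j; split; exact: fiber_holomorphic.
Qed.

Lemma cod_prod_atlas (i : idx A) : cod (A := prod_atlas A B) i =
  (fun u : Cn R (n + m) => lsubmx u : Cn R n) @^-1` cod i `&`
  (fun u : Cn R (n + m) => rsubmx u : Cn R m) @^-1` B.
Proof.
apply/seteqP; split=> [_ [p [pi pB] <-]|u [[x xi E] uB]].
  by split; rewrite /preimage /mkset /= ?row_mxKl ?row_mxKr//; exists p.1.
by exists (x, rsubmx u) => //=; rewrite E hsubmxK.
Qed.

Lemma open_overlap_prod (i : idx A) (j : idx F) :
  open (overlap (A := prod_atlas A B) (A' := F) i j).
Proof.
have cl (u : Cn R (n + m)) : {for u, continuous (fun u => lsubmx u : Cn R n)}.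
  exact/differentiable_continuous/differentiable_lsubmx.
have cr (u : Cn R (n + m)) : {for u, continuous (fun u => rsubmx u : Cn R m)}.
  exact/differentiable_continuous/differentiable_rsubmx.
apply: open_overlap.
- rewrite cod_prod_atlas; apply: openI.
    by apply: open_comp; [move=> u _; exact: cl|exact: (atlas_cod_open hA)].
  by apply: open_comp; [move=> u _; exact: cr|exact: (deform_base_open hF)].
- move=> [x b] [/= xi _]; rewrite row_mxKl row_mxKr.
  by rewrite (atlas_invK hA xi).
- move=> u; rewrite cod_prod_atlas => -[ui uB].
  have ci : {for u, continuous (fun u : Cn R (n + m) => inv i (lsubmx u : Cn R n))}.
    apply: (@continuous_comp _ _ _ (fun u : Cn R (n + m) => lsubmx u : Cn R n) (inv i)).
      exact: cl.
    exact: (atlas_inv_cont hA ui).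
  exact: (cvg_pair ci (cr u)).
- exact: (atlas_dom_open h).
Qed.

(** The smooth trivialization restricted to X x {t}: both changes of charts are first components of
    those between [prod_atlas A B] and [F], precomposed with the slice. *)
Lemma fiber_smooth_compatible : smooth_compatible A (fiber F t).
Proof.
have hf := fiber_complex_atlas.
move=> i j; have [s1 s2] := deform_smooth_triv hF i j; split=> k.
  have oU : open (overlap (A' := fiber F t) i j) by exact: (overlap_open hA hf).
  have UU' z : overlap (A' := fiber F t) i j z ->
      overlap (A := prod_atlas A B) (A' := F) i j (slice z).
    by move=> [x [xi xj] <-]; exists (x, t).
  have := smooth_lsubmx_slice oU (open_overlap_prod (i := i) (j := j)) UU' s1 k.
  congr Ck; apply/funext => z; rewrite /trans /slice /=.
  by rewrite row_mxKl row_mxKr.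
have oU : open (overlap (A := fiber F t) j i) by exact: (overlap_open hf hA).
have oU' : open (overlap (A := F) (A' := prod_atlas A B) j i).
  apply: open_overlap; [exact: (atlas_cod_open h)|exact: (atlas_invK h)| |].
    exact: (atlas_inv_cont h).
  apply: openI (fst @^-1` dom i) (snd @^-1` B) _ _; apply: open_comp.
  - by move=> p _; exact: cvg_fst.
  - exact: (atlas_dom_open hA).
  - by move=> p _; exact: cvg_snd.
  - exact: (deform_base_open hF).
have UU' z : overlap (A := fiber F t) j i z ->
    overlap (A := F) (A' := prod_atlas A B) j i (slice z).
  by move=> [x [xj xi] <-]; rewrite (chart_slice xj); exists (x, t).
have := smooth_lsubmx_slice oU oU' UU' s2 k.
by congr Ck; apply/funext => z; rewrite /trans /slice /= row_mxKl.
Qed.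

End Fiber.

Theorem theorem2p13 (R : realType) (X : topologicalType) (n m : nat)
    (A : atlas R X n) (B : set (Cn R m))
    (F : atlas R (X * Cn R m)%type (n + m)) (t : Cn R m)
    (phi : cochain A Tangent 1) (E : tensor_bundle)
    (hX : complex_manifold A) (hF : deformation A B F) (ht : B t)
    (hphi : beltrami (fiber F t) phi) :
  [/\ is_complex (deformed_dolbeault_complex E phi),
      is_complex (dolbeault_complex (fiber F t) E),
      complex_iso (deformed_dolbeault_complex E phi)
                  (dolbeault_complex (fiber F t) E)
    & forall q : nat,
        cohomology_iso (deformed_dolbeault_complex E phi)
                       (dolbeault_complex (fiber F t) E) q].
Proof.
have hA := manifold_atlas hX.
have hA' := fiber_complex_atlas hF ht.
have hs := fiber_smooth_compatible hA hF ht.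
have c1 := deformed_is_complex E hA hA' hs hphi.
have c2 := dolbeault_is_complex E hA'.
have iso := deformed_complex_iso E hA hA' hs hphi.
by split=> // q; exact: complex_iso_cohomology.
Qed.
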